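(* For integers $N>0$ and $n,r>0$, the coefficients of the series $B_1(q)$ (depending on $N$ and $r$) are explicitly given by $$[q^n]B_1(q)=-\frac12\binom{n(N+r)-1}{nr}.$$
   Context: $B_1(q)$ is defined as follows. Let $S=\mathbb{C}^2$ and $\mathsf{T}=\mathsf{T}_0\times\mathsf{T}_1\times\mathsf{T}_2$, where $\mathsf{T}_0=\{(t_1,t_2)\in(\mathbb{C}^* )^2:t_1t_2=1\}$ acts on $S$ with tangent weights $t_1,t_2$, and $\mathsf{T}_1,\mathsf{T}_2$ have coordinates $y_i,v_i$ and act trivially on $S$. First Chern classes: $c_1(t_1)=\lambda=-c_1(t_2)$, $c_1(y_i)=m_i$, $c_1(v_i)=w_i$; weights are identified with their Chern characters. $E=\bigoplus_{i=1}^N\mathcal{O}_S\langle y_i\rangle$ and $\alpha=[\bigoplus_{i\le a}\mathcal{O}_S\langle v_i\rangle]-[\bigoplus_{a<i\le a+b}\mathcal{O}_S\langle v_i\rangle]$ of rank $r=a-b>0$. The fixed points $Z_\pi$ of $\operatorname{Quot}_S(E,n)$ are indexed by $N$-tuples of partitions $\pi=(\pi^{(1)},\dots,\pi^{(N)})$ of total size $|\pi|=n$. With boxes $\{(i,j)\in\mathbb{Z}_{\ge0}^2:j<\rho_{i+1}\}$ for a partition $\rho$ and $Q_k=\sum_{(i,j)\in\pi^{(k)}}t_1^{-j}t_2^{-i}$: $T^{\mathrm{red}}_{Z_\pi}=1+\sum_{k,l}(Q_l-(1-t_1)(1-t_2)\overline{Q_k}Q_l)y_k^{-1}y_l$ modulo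 $t_1t_2=1$ (bar inverts $t_1,t_2$), and $\alpha^{[n]}|_{Z_\pi}=\sum_k(\sum_{i\le a}v_i-\sum_{i>a}v_i)y_kQ_k$. For a virtual character $\gamma=\sum n_\chi\chi$: $\det\gamma=\prod\chi^{n_\chi}$, $\operatorname{ch}(\Lambda_{-1}\gamma^\vee)=\prod(1-\chi^{-1})^{n_\chi}$. The reduced Verlinde series is $$\mathcal{V}^{\mathrm{red}}(E,\alpha;q)=\sum_{|\pi|>0}q^{|\pi|}\frac{\operatorname{ch}(\det\alpha^{[n]}|_{Z_\pi})}{\operatorname{ch}(\Lambda_{-1}(T^{\mathrm{red}}_{Z_\pi})^\vee)},$$ a fixed point with negative multiplicity of the trivial weight in $T^{\mathrm{red}}$ contributing $0$; $\mathcal{V}^{\mathrm{red}}_0$ is its part of total degree $0$ in $(\lambda,\vec m,\vec w)$ (coefficient of $b^0$ after scaling all these variables by $b$). Writing $c_1(\alpha)=c_1\lambda$ with $c_1\in\mathbb{Q}$ (the weights of $\alpha$ being specialized to $\mathsf{T}_0$-weights), one has $$\mathcal{V}^{\mathrm{red}}_0(E,\alpha;q)|_{m_1=\dots=m_N=0}=B_1(q)c_1^2+B_0(q)$$ for power series $B_1,B_0$ depending only on $N,r$; this defines $B_1(q)$. Equivalently $B_1(q)=-\log B_{(1,1),(0),(0)}(q)$, where $B_{\mu,\nu,\xi}$ are the universal series (depending on $N,r$) with $\mathcal{V}_S(E,\alpha;q)=\prod_{\mu,\nu,\xi}B_{\mu,\nu,\xi}(q)^{\int_Sc_\mu(\alpha)c_\nu(S)c_\xi(E)c_1(S)}$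 for the non-reduced equivariant virtual Verlinde series for the full torus $(\mathbb{C}^* )^2$ on $S$ (same sum over all $\pi$, including $|\pi|=0$, with $t_1,t_2$ independent and $T^{\mathrm{vir}}=T^{\mathrm{red}}-1$; $\int_S\gamma=\gamma/(\lambda_1\lambda_2)$, $c_\mu=\prod c_{\mu_i}$). $[q^n]$ denotes the coefficient of $q^n$. *)

(* Defs.v *)
From HB Require Import structures.
From mathcomp Require Import all_boot all_order all_algebra.
From mathcomp Require Import freeg mpoly.

Set Implicit Arguments.
Unset Strict Implicit.
Unset Printing Implicit Defensive.
Import GRing.Theory.
Local Open Scope ring_scope.

(** * Laurent series in one variable b over a field *)

Section Laurent.
Variable F : fieldType.
Implicit Types (f g : nat -> F).

Definition ps_mul f g : nat -> F :=
  fun n => \sum_(i < n.+1) f i * g (n - i)%N.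

Fixpoint ps_inv_seq f n : seq F :=
  if n is m.+1 then
    let s := ps_inv_seq f m in
    rcons s (- (f 0%N)^-1 * \sum_(i < n) f (n - i)%N * s`_i)
  else [:: (f 0%N)^-1].

(* The inverse of sum_n (f n) b^n; meaningful when f 0 != 0. *)
Definition ps_inv f : nat -> F := fun n => (ps_inv_seq f n)`_n.

(* [Laurent v f] stands for b^v * sum_n (f n) b^n. The representation is not
   required to be normalized, but [linv] is only meaningful when f 0 != 0. *)
Record laurent := Laurent { lord : int; lser : nat -> F }.

Definition lone := Laurent 0 (fun n => (n == 0%N)%:R).

Definition lmul x y :=
  Laurent (lord x + lord y) (ps_mul (lser x) (lser y)).

Definition linv x := Laurent (- lord x) (ps_inv (lser x)).

Definition lpow x (z : int) :=
  match z with
  | Posz n => iter n (lmul x) lone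
  | Negz n => iter n.+1 (lmul (linv x)) lone
  end.

(* The coefficient of b^0. *)
Definition lcoef0 x : F :=
  match - lord x with
  | Posz n => lser x n
  | Negz _ => 0
  end.

(* exp(b x) *)
Definition lexp (x : F) := Laurent 0 (fun n => x ^+ n / (n`!)%:R).

(* 1 - exp(-b x) = b * sum_n (-1)^n x^(n+1) / (n+1)! b^n,
   normalized as soon as x != 0. *)
Definition lone_sub_expN (x : F) :=
  Laurent 1 (fun n => (-1) ^+ n * x ^+ n.+1 / (n.+1`!)%:R).

End Laurent.

(** * Virtual characters of a torus *)

(* The characters of a torus of rank d, written additively (so that 0 is the
   trivial character), and their group ring, with product [vmul]: {freeg K} is
   the free abelian group on K. *)
Definition weight (d : nat) := 'rV[int]_d.
Definition vchar (d : nat) := {freeg (weight d)}.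

Section Vchar.
Variable d : nat.
Implicit Types (g h : vchar d).

Definition vwt (x : weight d) : vchar d := << x >>.

Definition vmul g h : vchar d :=
  \sum_(x <- dom g) \sum_(y <- dom h) << coeff x g * coeff y h *g (x + y) >>.

Definition vdual g : vchar d := \sum_(x <- dom g) << coeff x g *g (- x) >>.

Definition vdet g : weight d := \sum_(x <- dom g) x *~ coeff x g.

(* Rational functions in the Chern classes of the d coordinate characters. *)
Definition ratfun := {fraction {mpoly rat[d]}}.

Definition chern (x : weight d) : ratfun :=
  FracField.tofrac (\sum_(i < d) (x 0 i)%:~R *: 'X_i).

(* From now on all the Chern classes are scaled by b. *)
Definition ch (x : weight d) : laurent ratfun := lexp (chern x).

(* ch(Lambda_{-1} g^vee) *)
Definition chLambda g : laurent ratfun :=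
  \big[@lmul _/lone _]_(x <- dom g) lpow (lone_sub_expN (chern x)) (coeff x g).

End Vchar.

Notation "g ** h" := (vmul g h) (at level 40, left associativity) : ring_scope.

(** * Partitions *)

(* A partition of size at most n, as the non-increasing sequence of its parts
   padded with zeros to length n. Indices start at 0: the boxes are the (i, j)
   with j < rho i. *)
Definition ptn (n : nat) := {ffun 'I_n -> 'I_n.+1}.

Definition is_ptn n (rho : ptn n) : bool :=
  [forall i : 'I_n, forall j : 'I_n, (i <= j)%N ==> (rho j <= rho i)%N].

Definition is_ptn_tuple N n (p : {ffun 'I_N -> ptn n}) : bool :=
  [forall k, is_ptn (p k)] && (\sum_k \sum_i (p k i : nat) == n)%N.

(** * The reduced Verlinde series *)

Section Verlinde.
Variables (N a b : nat).

(* Coordinates on T_0 x T_1 x T_2: lambda, then m_1..m_N, then w_1..w_(a+b). *)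
Definition rk := (1 + N + (a + b))%N.
Local Notation W := (weight rk).
Local Notation V := (vchar rk).

Definition ilam : 'I_rk := lshift (a + b) (lshift N (ord0 : 'I_1)).
Definition im (k : 'I_N) : 'I_rk := lshift (a + b) (rshift 1 k).
Definition iw (i : 'I_(a + b)) : 'I_rk := rshift (1 + N) i.

(* T_0 is the subtorus t1 t2 = 1. *)
Definition t1 : W := delta_mx 0 ilam.
Definition t2 : W := - t1.
Definition y (k : 'I_N) : W := delta_mx 0 (im k).
Definition v (i : 'I_(a + b)) : W := delta_mx 0 (iw i).

Definition alpha : V :=
  \sum_(i < a) vwt (v (lshift b i)) - \sum_(j < b) vwt (v (rshift a j)).

Section FixedPoint.
Variables (n : nat) (p : {ffun 'I_N -> ptn n}).

Definition Q (k : 'I_N) : V :=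
  \sum_(i < n) \sum_(j < n | (j < p k i)%N) vwt (- (t1 *+ j) - (t2 *+ i)).

Definition Tred : V :=
  vwt 0 + \sum_k \sum_l
    (Q l - (vwt 0 - vwt t1) ** (vwt 0 - vwt t2) ** vdual (Q k) ** Q l)
      ** vwt (- y k + y l).

Definition alpha_taut : V := \sum_k alpha ** vwt (y k) ** Q k.

Definition contribution : laurent (ratfun rk) :=
  lmul (ch (vdet alpha_taut)) (linv (chLambda Tred)).

Definition contribution0 : ratfun rk :=
  if coeff 0 Tred < 0 then 0 else lcoef0 contribution.

End FixedPoint.

(* [q^n] of the degree 0 part of the reduced Verlinde series. *)
Definition Vred0 (n : nat) : ratfun rk :=
  if n is 0%N then 0 else
  \sum_(p : {ffun 'I_N -> ptn n} | is_ptn_tuple p) contribution0 p.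

(* The specialization m_k = 0, w_i = c_i lambda, where lambda is 'X. *)
Definition spec_var (c : 'I_(a + b) -> rat) (i : 'I_rk) : {poly rat} :=
  match split i with
  | inl j => match split j with inl _ => 'X | inr _ => 0 end
  | inr j => c j *: 'X
  end.

Definition spec (c : 'I_(a + b) -> rat) (f : {mpoly rat[rk]}) : {poly rat} :=
  mmap polyC (spec_var c) f.

(* The rational function f is regular at the generic point of the locus
   m_k = 0, w_i = c_i lambda, and restricts there to the constant x. (A single
   summand of [Vred0] may have poles along m_k = m_l.) *)
Definition restricts_to (c : 'I_(a + b) -> rat) (f : ratfun rk) (x : rat) :=
  exists f1 f2 : {mpoly rat[rk]},
    [/\ spec c f2 != 0,
        f = FracField.tofrac f1 / FracField.tofrac f2
      & spec c f1 = x *: spec c f2].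

(* c_1(alpha) = (c1 c) lambda when w_i = c_i lambda. *)
Definition c1 (c : 'I_(a + b) -> rat) : rat :=
  \sum_(i < a) c (lshift b i) - \sum_(j < b) c (rshift a j).

End Verlinde.

(* B1, given by its coefficients, is the series of the decomposition
   Vred0 |_{m = 0} = B1(q) c1^2 + B0(q), with B1 and B0 depending only on N
   and r: the same pair serves all alpha of rank r and all T_0-weights. *)
Definition is_B1 (N r : nat) (B1 : nat -> rat) : Prop :=
  exists B0 : nat -> rat,
    forall (a b : nat) (c : 'I_(a + b) -> rat), a = (b + r)%N ->
    forall n : nat,
      restricts_to c (Vred0 N a b n) (B1 n * c1 c ^+ 2 + B0 n).

(* Main.v *)
From HB Require Import structures.
Require Import Defs.
From mathcomp Require Import all_boot all_order all_algebra.
From mathcomp Require Import freeg mpoly.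
From mathcomp Require Import boolp.
From mathcomp Require Import ring zify.

Set Implicit Arguments.
Unset Strict Implicit.
Unset Printing Implicit Defensive.
Import Order.TTheory GRing.Theory Num.Theory.
Local Open Scope ring_scope.

(** Put t = t1, so that the second weight of the plane is - t, and write weights
    additively.  In the reduced tangent character at a tuple of partitions, the
    multiplicity of the trivial weight is 1 plus the sum over the partitions of
    n_0 - sum_c (n_c - n_(c+1))^2, where n_c is the number of boxes of content
    c.  Squares of integers dominate absolute values, and the n_c climb from 0 to
    n_0 and come down again, so this multiplicity is at most 1 minus the total
    number of diagonal boxes ([coeff0_Tred_le]).  Hence only those tuples
    contribute in which one partition is a hook and all the others are empty
    ([hook_tuple_of_durfee], [Vred0_hooks]).

    Index these tuples by (k, l), with k the place of the hook and l < n its leg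
    length, and attach to (k, l) the weight x_(k,l) = y_k + l t.  The tangent
    character at (k, l) is then n t, - n t, and all the differences
    x_(k,l) - x_j for j distinct from (k, l) ([Tred_hook]), while the determinant
    of the tautological class is n det(alpha) + r (n x_(k,l) - 'C(n, 2) t)
    ([vdet_alpha_taut_hook]).  With p_j = exp(b x_j) and M = N n points, the
    contributions are therefore, up to a common factor, the terms of
      sum_i p_i^(r n + M - 1) / prod_(j != i) (p_i - p_j) = h_(r n)(p),
    the divided difference of a monomial, which is a complete homogeneous
    symmetric function of the p_j ([ddiff_expr]).  So the coefficient of q^n is
      exp(n L b - r 'C(n, 2) t b) h_(r n)(p) / ((1 - exp(n t b)) (1 - exp(- n t b)))
    with L = c_1(alpha) ([sum_lval_contribution]).

    The denominator starts with - (n t b)^2, and at b = 0 all the p_j are 1, where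
    h_(r n) counts the monomials of degree r n in M variables.  Hence the part of
    degree 0 in b has L^2 coefficient - 'C(n (N + r) - 1, n r) / (2 t^2), and the
    remaining part is (L u + v) / t^2 with u and v independent of the weights of
    alpha ([Vred0E], [spec_indep_regular_factor]).  Taking the second difference
    in c_1 = 1, 0, -1 isolates B1. *)

(** * The integral domain of formal power series *)

(** A wrapper around sequences, so that their product can be the Cauchy product
    rather than the pointwise one. *)
Record pser (F : fieldType) := PSer { pscoef :> nat -> F }.

Section PowerSeriesRing.
Variable F : fieldType.
Implicit Types f g h : pser F.

HB.instance Definition _ := gen_eqMixin (pser F).
HB.instance Definition _ := gen_choiceMixin (pser F).

Lemma pserP f g : (f =1 g) -> f = g.
Proof. by case: f => f; case: g => g /= /funext ->. Qed.

Definition pser_add f g := PSer (fun n => f n + g n).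
Definition pser_opp f := PSer (fun n => - f n).
Definition pser_mul f g := PSer (ps_mul f g).
Definition pser_one : pser F := PSer (fun n => (n == 0%N)%:R).
(** Coefficients of a product depend on finitely many coefficients of the factors,
    so associativity and commutativity are inherited from polynomials. *)
Definition pser_trunc f m : {poly F} := \poly_(i < m) f i.

Lemma ps_mulE f g n m : (n < m)%N ->
  ps_mul f g n = (pser_trunc f m * pser_trunc g m)`_n.
Proof.
move=> ltnm; rewrite coefM; apply: eq_bigr => i _; rewrite !coef_poly.
have ltim : (i < m)%N by apply: leq_ltn_trans ltnm; rewrite -ltnS.
by rewrite ltim (leq_ltn_trans (leq_subr _ _) ltnm).
Qed.

Lemma pser_addA : associative pser_add.
Proof. by move=> f g h; apply: pserP => n /=; rewrite addrA. Qed.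
Lemma pser_addC : commutative pser_add.
Proof. by move=> f g; apply: pserP => n /=; rewrite addrC. Qed.
Lemma pser_add0 : left_id (PSer (fun=> 0)) pser_add.
Proof. by move=> f; apply: pserP => n /=; rewrite add0r. Qed.
Lemma pser_addN : left_inverse (PSer (fun=> 0)) pser_opp pser_add.
Proof. by move=> f; apply: pserP => n /=; rewrite addNr. Qed.

HB.instance Definition _ := GRing.isZmodule.Build (pser F)
  pser_addA pser_addC pser_add0 pser_addN.

Lemma pser_mulC : commutative pser_mul.
Proof.
by move=> f g; apply: pserP => n /=; rewrite !(ps_mulE _ _ (ltnSn n)) mulrC.
Qed.

Lemma pser_mulA : associative pser_mul.
Proof.
move=> f g h; apply: pserP => n /=.
have -> : ps_mul f (ps_mul g h) n =
    (pser_trunc f n.+1 * (pser_trunc g n.+1 * pser_trunc h n.+1))`_n.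
  rewrite coefM; apply: eq_bigr => i _; rewrite coef_poly ltn_ord.
  by congr (_ * _); apply: ps_mulE; rewrite ltnS leq_subr.
rewrite mulrA coefM; apply: eq_bigr => i _.
by rewrite (ps_mulE _ _ (ltn_ord i)) [X in _ * X]coef_poly ltnS leq_subr.
Qed.

Lemma pser_mul1 : left_id pser_one pser_mul.
Proof.
move=> f; apply: pserP => n /=; rewrite /ps_mul big_ord_recl mul1r subn0.
by rewrite big1 ?addr0 // => i _; rewrite mul0r.
Qed.

Lemma pser_mulDl : left_distributive pser_mul pser_add.
Proof.
move=> f g h; apply: pserP => n /=; rewrite /ps_mul -big_split.
by apply: eq_bigr => i _; rewrite mulrDl.
Qed.

Lemma pser_one_neq0 : pser_one != 0.
Proof.
by apply/eqP => /(congr1 (fun f : pser F => f 0%N)) /= /eqP; rewrite oner_eq0.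
Qed.

HB.instance Definition _ := GRing.Zmodule_isComNzRing.Build (pser F)
  pser_mulA pser_mulC pser_mul1 pser_mulDl pser_one_neq0.

Lemma coef_ps0 n : (0 : pser F) n = 0. Proof. by []. Qed.
Lemma coef_psD f g n : (f + g) n = f n + g n. Proof. by []. Qed.
Lemma coef_psN f n : (- f) n = - f n. Proof. by []. Qed.
Lemma coef_psM f g n : (f * g) n = \sum_(i < n.+1) f i * g (n - i)%N.
Proof. by []. Qed.
Lemma coef_ps1 n : (1 : pser F) n = (n == 0%N)%:R. Proof. by []. Qed.

Lemma coef_ps_sum (I : Type) (r : seq I) (P : pred I) (G : I -> pser F) n :
  (\sum_(i <- r | P i) G i) n = \sum_(i <- r | P i) G i n.
Proof. by elim/big_rec2: _ => // i _ y _ <-. Qed.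

Lemma coef_psM0 f g : (f * g) 0%N = f 0%N * g 0%N.
Proof. by rewrite coef_psM big_ord_recl big_ord0 addr0. Qed.

Definition psX : pser F := PSer (fun n => (n == 1%N)%:R).

Lemma coef_psXM f n : (psX * f) n = if n is m.+1 then f m else 0.
Proof.
rewrite coef_psM; case: n => [|n]; first by rewrite big_ord1 mul0r.
rewrite big_ord_recl mul0r add0r big_ord_recl mul1r subn1 big1 ?addr0 //.
by move=> i _; rewrite mul0r.
Qed.

Lemma coef_psXnM f k n :
  (psX ^+ k * f) n = if (n < k)%N then 0 else f (n - k)%N.
Proof.
elim: k n => [|k IHk] n; first by rewrite mul1r subn0.
by rewrite exprS -mulrA coef_psXM; case: n => // n; rewrite IHk ltnS subSS.
Qed.

Lemma ps_inv_seq_size (f : nat -> F) n : size (ps_inv_seq f n) = n.+1.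
Proof. by elim: n => //= n IHn; rewrite size_rcons IHn. Qed.

Lemma nth_ps_inv_seq (f : nat -> F) n i :
  (i <= n)%N -> (ps_inv_seq f n)`_i = ps_inv f i.
Proof.
elim: n => [|n IHn]; first by rewrite leqn0 => /eqP->.
rewrite leq_eqVlt => /predU1P[-> //|ltin] /=.
by rewrite nth_rcons ps_inv_seq_size ltin IHn.
Qed.

Lemma ps_invS (f : nat -> F) n : ps_inv f n.+1 =
  - (f 0%N)^-1 * \sum_(i < n.+1) f (n.+1 - i)%N * ps_inv f i.
Proof.
rewrite /ps_inv /= nth_rcons ps_inv_seq_size ltnn eqxx; congr (_ * _).
by apply: eq_bigr => i _; rewrite nth_ps_inv_seq // -ltnS.
Qed.

Definition pser_unit : pred (pser F) := fun f => f 0%N != 0.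
Definition pser_inv f := if f 0%N != 0 then PSer (ps_inv f) else f.

Lemma pser_mulV : {in pser_unit, left_inverse 1 pser_inv *%R}.
Proof.
move=> f; rewrite /pser_inv /in_mem /= /pser_unit => nzf0; rewrite nzf0.
apply: pserP => n; rewrite coef_psM coef_ps1.
case: n => [|n]; first by rewrite big_ord1 mulVf.
rewrite big_ord_recr /= subnn ps_invS mulrAC mulNr mulVf // mulN1r.
apply/eqP; rewrite subr_eq0; apply/eqP/eq_bigr => i _.
by rewrite mulrC.
Qed.

Lemma pser_unitP f g : g * f = 1 -> f \in pser_unit.
Proof.
move/(congr1 (fun h : pser F => h 0%N)); rewrite coef_psM0 coef_ps1 => fg1.
rewrite /in_mem /= /pser_unit; apply: contra_eq_neq fg1 => ->.
by rewrite mulr0 eq_sym oner_eq0.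
Qed.

Lemma pser_inv_out : {in [predC pser_unit], pser_inv =1 id}.
Proof. by move=> f; rewrite inE /in_mem /= /pser_inv /pser_unit; case: ifP. Qed.

HB.instance Definition _ := GRing.ComNzRing_hasMulInverse.Build (pser F)
  pser_mulV pser_unitP pser_inv_out.

(** Factoring out the lowest power of the variable; classical, as the valuation of
    a sequence cannot be computed. *)
Lemma pser_neq0 f : f != 0 -> exists k g, g 0%N != 0 /\ f = psX ^+ k * g.
Proof.
move=> nzf; have exf : exists n, f n != 0.
  case: (pselect (exists n, f n != 0)) => // f0; case/eqP: nzf.
  by apply: pserP => n; apply/eqP/negPn/negP => fn; case: f0; exists n.
case: (ex_minnP exf) => k fk mink; exists k, (PSer (fun n => f (n + k)%N)).
split=> //; apply: pserP => n; rewrite coef_psXnM; case: ltnP => [ltnk|leknk] /=.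
  by apply/eqP; apply: contraTT ltnk => /mink; rewrite -leqNgt.
by rewrite subnK.
Qed.

Lemma pser_integral f g : f * g = 0 -> (f == 0) || (g == 0).
Proof.
move=> fg0; apply/norP => -[/pser_neq0[k [f1 [nz1 Df]]] /pser_neq0[l [g1 [nz2 Dg]]]].
move/(congr1 (fun h : pser F => h (k + l)%N)): fg0.
rewrite Df Dg mulrACA -exprD coef_psXnM ltnn subnn coef_psM0 => /eqP.
by rewrite mulf_eq0 (negPf nz1) (negPf nz2).
Qed.

HB.instance Definition _ := GRing.ComUnitRing_isIntegral.Build (pser F)
  pser_integral.

Lemma psX_neq0 : psX != 0.
Proof.
by apply/eqP => /(congr1 (fun f : pser F => f 1%N)) /= /eqP; rewrite oner_eq0.
Qed.

Lemma pser_unitE f : (f \is a GRing.unit) = (f 0%N != 0). Proof. by []. Qed.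

Lemma pser_invE f : f 0%N != 0 -> PSer (ps_inv f) = f^-1.
Proof. by move=> nz; rewrite /GRing.inv /= /pser_inv nz. Qed.

End PowerSeriesRing.

(** * Series with coefficients in a subring *)

Section Subring.
Variables (F : fieldType) (S : subringClosed F).
Implicit Types f g : pser F.
Definition ps_over (f : pser F) := forall n, f n \in S.

Lemma ps_over1 : ps_over 1.
Proof. by move=> n; rewrite coef_ps1; case: eqP; rewrite ?rpred0 ?rpred1. Qed.

Lemma ps_overD f g : ps_over f -> ps_over g -> ps_over (f + g).
Proof. by move=> Sf Sg n; rewrite coef_psD rpredD. Qed.

Lemma ps_overM f g : ps_over f -> ps_over g -> ps_over (f * g).
Proof. by move=> Sf Sg n; rewrite coef_psM rpred_sum // => i _; rewrite rpredM. Qed.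

(** With constant term 1, the recursion for the coefficients of the inverse
    involves no division. *)
Lemma ps_overV f : f 0%N = 1 -> ps_over f -> ps_over f^-1.
Proof.
move=> f0 Sf; have nz : f 0%N != 0 by rewrite f0 oner_eq0.
rewrite -(pser_invE nz) => n /=; elim/ltn_ind: n => -[_|n IHn].
  by rewrite /ps_inv /= f0 invr1 rpred1.
rewrite ps_invS f0 invr1 mulN1r rpredN rpred_sum // => i _.
by rewrite rpredM // IHn.
Qed.
End Subring.

(** * Exponential series *)

Section Exponential.
Variable F : fieldType.
Hypothesis char0 : forall n, n.+1%:R != 0 :> F.
Implicit Types x y : F.

Definition pexp x : pser F := PSer (lser (lexp x)).

Lemma factr_neq0 n : (n`!)%:R != 0 :> F.
Proof. by case: (n`!) (fact_gt0 n) => // m _; apply: char0. Qed.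

Lemma pexpE x n : pexp x n = x ^+ n / (n`!)%:R. Proof. by []. Qed.

Lemma pexp0 : pexp 0 = 1.
Proof.
apply: pserP => n; rewrite pexpE coef_ps1 expr0n.
by case: n => [|n]; rewrite ?mul0r // mul1r ?fact0 invr1.
Qed.

Lemma pexp_coef0 x : pexp x 0%N = 1.
Proof. by rewrite pexpE expr0 fact0 invr1 mulr1. Qed.

(** The binomial theorem, coefficient by coefficient. *)
Lemma pexpD x y : pexp (x + y) = pexp x * pexp y.
Proof.
apply: pserP => n; rewrite coef_psM !pexpE addrC exprDn mulr_suml.
apply: eq_bigr => i _; rewrite !pexpE.
have lein : (i <= n)%N by rewrite -ltnS.
have /(congr1 (fun m => m%:R : F)) := bin_fact lein; rewrite !natrM => Dbin.
have nzi := factr_neq0 i; have nzni := factr_neq0 (n - i); have nzn := factr_neq0 n.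
rewrite -Dbin in nzn *; rewrite -mulr_natr; field.
by move: nzn; rewrite !mulf_eq0 !negb_or nzi nzni; case/andP=> ->.
Qed.

Lemma pexpMn x n : pexp (x *+ n) = pexp x ^+ n.
Proof. by elim: n => [|n IHn]; rewrite ?pexp0 // mulrS pexpD IHn exprS. Qed.

Lemma pexp_inj : injective pexp.
Proof.
move=> x y /(congr1 (fun f : pser F => f 1%N)).
by rewrite !pexpE !expr1 -[(1`!)%:R]/(1 : F) !divr1.
Qed.

(** The series (1 - exp(- b x)) / b, a denominator of localization freed of its
    zero at b = 0. *)
Definition todd_den x : pser F := PSer (lser (lone_sub_expN x)).

Lemma todd_denE x n : todd_den x n = (-1) ^+ n * x ^+ n.+1 / (n.+1`!)%:R.
Proof. by []. Qed.

Lemma psX_todd_den x : psX F * todd_den x = 1 - pexp (- x).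
Proof.
apply: pserP => n; rewrite coef_psXM coef_psD coef_psN coef_ps1 pexpE.
case: n => [|n]; first by rewrite expr0 fact0 invr1 mulr1 subrr.
by rewrite todd_denE sub0r [in RHS]exprNn [in RHS](exprS (-1)) mulN1r !mulNr opprK.
Qed.

Lemma todd_den_coef0 x : todd_den x 0%N = x.
Proof. by rewrite todd_denE mul1r expr1 -[(1`!)%:R]/(1 : F) divr1. Qed.

End Exponential.

(** * Laurent series as elements of a field *)

Section LaurentField.
Variable F : fieldType.
Implicit Types x y : laurent F.
Local Notation L := {fraction (pser F)}.
Local Notation tofrac := FracField.tofrac.
Local Notation b := (tofrac (psX F)).

(** A pair of an order and a series is not a unique representation; its value in
    the fraction field of the power series is what field identities act on. *)
Definition lval x : L := b ^ lord x * tofrac (PSer (lser x)).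

Lemma lval_pser (k : int) (f : pser F) : lval (Laurent k f) = b ^ k * tofrac f.
Proof. by case: f. Qed.

Definition lnormal x := lser x 0%N != 0.

Lemma lvar_neq0 : b != 0. Proof. by rewrite tofrac_eq0 psX_neq0. Qed.

Lemma lval1 : lval (lone F) = 1.
Proof. by rewrite /lval expr0z mul1r -tofrac1. Qed.

Lemma lvalM x y : lval (lmul x y) = lval x * lval y.
Proof. by rewrite /lval /= expfzDr ?lvar_neq0 // mulrACA -tofracM. Qed.

Lemma lnormal1 : lnormal (lone F). Proof. exact: oner_neq0. Qed.

Lemma lnormalM x y : lnormal x -> lnormal y -> lnormal (lmul x y).
Proof.
move=> nx ny; rewrite /lnormal /= -[ps_mul _ _]/(pscoef (PSer (lser x) * PSer (lser y))).
by rewrite coef_psM0 mulf_neq0.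
Qed.

Lemma lvalV x : lnormal x -> lval (linv x) = (lval x)^-1.
Proof.
move=> nx; rewrite /lval /= invfM invr_expz ; congr (_ * _).
by rewrite -rmorphV // -pser_invE.
Qed.

Lemma lval_pown x n : lval (lpow x (Posz n)) = lval x ^+ n.
Proof. by elim: n => [|n IHn] /=; rewrite ?lval1 // lvalM IHn exprS. Qed.

Lemma lnormal_pown x n : lnormal x -> lnormal (lpow x (Posz n)).
Proof.
by move=> nx; elim: n => [|n IHn] /=; [exact: lnormal1 | exact: lnormalM].
Qed.

Lemma lval_prod (I : Type) (r : seq I) (G : I -> laurent F) :
  lval (\big[@lmul F/lone F]_(i <- r) G i) = \prod_(i <- r) lval (G i).
Proof. by elim/big_rec2: _ => [|i y x _ <-]; rewrite ?lval1 ?lvalM. Qed.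

Lemma lnormal_prod (I : eqType) (r : seq I) (G : I -> laurent F) :
  (forall i, i \in r -> lnormal (G i)) ->
  lnormal (\big[@lmul F/lone F]_(i <- r) G i).
Proof.
move=> nG; rewrite big_seq; elim/big_rec: _ => [|i x /nG]; first exact: lnormal1.
exact: lnormalM.
Qed.

Lemma lval_exp c : lval (lexp c) = tofrac (pexp c).
Proof. by rewrite /lval expr0z mul1r. Qed.

Lemma lval_one_sub_expN c : lval (lone_sub_expN c) = 1 - tofrac (pexp (- c)).
Proof. by rewrite /lval expr1z -tofracM -tofrac1 -tofracB psX_todd_den. Qed.

(** Multiplying by a large power of b turns the coefficient of b^0 into an ordinary
    coefficient, whatever the representation. *)
Lemma lcoef0E x k (f : pser F) :
  lval x * b ^+ k = tofrac f -> lcoef0 x = f k.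
Proof.
rewrite /lval mulrAC -[b ^+ k]/(b ^ Posz k) -expfzDr ?lvar_neq0 // => Df.
rewrite /lcoef0; move Dm: (lord x + k%:Z) Df => m Df.
have -> : - lord x = k%:Z - m by rewrite -Dm opprD addrCA subrr addr0.
case: m {Dm} Df => [m|m] Df.
  have <- : psX F ^+ m * PSer (lser x) = f.
    by apply/eqP; rewrite -tofrac_eq tofracM tofracXn Df.
  rewrite coef_psXnM; case: leqP => [lemk | ltkm]; first by rewrite subzn.
  rewrite -opprB subzn ?(ltnW ltkm) //.
  by case: (m - k)%N (subn_gt0 k m) => [|d]; rewrite ltkm.
have Ds : PSer (lser x) = psX F ^+ m.+1 * f.
  apply/eqP; rewrite -tofrac_eq tofracM tofracXn -Df NegzE -exprnN mulrA.
  by rewrite divff ?mul1r // expf_neq0 // lvar_neq0.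
rewrite NegzE opprK -PoszD -[lser x _]/(PSer (lser x) _) Ds.
by rewrite coef_psXnM ltnNge leq_addl addnK.
Qed.

(** Transfers an identity between sums in the field of Laurent series to the
    coefficients of b^0. *)
Lemma lcoef0_sum (I : finType) (P : pred I) (G : I -> laurent F) z :
  \sum_(i | P i) lval (G i) = lval z -> \sum_(i | P i) lcoef0 (G i) = lcoef0 z.
Proof.
move=> Dz.
(* A power of b clearing the denominators of all the terms at once. *)
pose k := (\sum_i `|lord (G i)|)%N.
have bK i : exists f, lval (G i) * b ^+ k = tofrac f.
  have [d Dd] : exists d : nat, lord (G i) + k%:Z = d%:Z.
    rewrite /k (bigD1 i) //= PoszD addrA.
    case: (lord (G i)) => m; first by rewrite -!PoszD; eexists.
    by rewrite NegzE -[absz _]/(m.+1) addNr add0r; eexists.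
  exists (psX F ^+ d * PSer (lser (G i))).
  rewrite /lval mulrAC -[b ^+ k]/(b ^ Posz k) -expfzDr ?lvar_neq0 // Dd.
  by rewrite tofracM tofracXn.
pose f i := projT1 (cid (bK i)).
have Df i : lval (G i) * b ^+ k = tofrac (f i) by rewrite /f; case: cid.
rewrite (lcoef0E (x := z) (k := k) (f := \sum_(i | P i) f i)).
  by rewrite coef_ps_sum; apply: eq_bigr => i _; apply: lcoef0E.
rewrite -Dz mulr_suml raddf_sum.
by apply: eq_bigr => i _.
Qed.
End LaurentField.

(** * Complete homogeneous symmetric functions and divided differences *)

Section CompleteHomogeneous.
Variable R : comNzRingType.
Implicit Type s : seq R.

(** Sorting the monomials of degree k by the exponent j of the first variable. *)
Fixpoint hsym s (k : nat) : R :=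
  if s is x :: s' then \sum_(j < k.+1) x ^+ j * hsym s' (k - j)%N else (k == 0%N)%:R.

Lemma hsym0 s : hsym s 0 = 1.
Proof. by elim: s => //= x s IHs; rewrite big_ord1 mul1r. Qed.

Lemma hsymS x s k : hsym (x :: s) k.+1 = hsym s k.+1 + x * hsym (x :: s) k.
Proof.
rewrite [LHS]big_ord_recl mul1r -[(k.+1 - ord0)%N]/(k.+1); congr (_ + _).
rewrite [hsym _ k]/= mulr_sumr.
by apply: eq_bigr => j _; rewrite exprS mulrA.
Qed.

(** The number of monomials of degree k in M + 1 variables. *)
Lemma hsym_ones M k : hsym (nseq M.+1 1) k = 'C(k + M, k)%:R.
Proof.
elim: M k => [|M IHM]; elim=> [|k IHk]; rewrite ?hsym0 ?bin0 //.
  by rewrite [nseq _ _]/= hsymS -[[:: 1]]/(nseq 1 1) IHk add0r mul1r !addn0 !binn.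
have -> : nseq M.+2 1 = 1 :: nseq M.+1 1 :> seq R by [].
rewrite hsymS IHM mul1r -[1 :: _]/(nseq M.+2 1) IHk.
by rewrite -natrD -addSnnS [(k.+1 + M.+1)%N]addnS binS.
Qed.

End CompleteHomogeneous.

Lemma hsym_map (A B : comNzRingType) (f : {rmorphism A -> B}) (s : seq A) k :
  hsym [seq f x | x <- s] k = f (hsym s k).
Proof.
elim: s k => [|x s IHs] k; first by rewrite /= rmorph_nat.
rewrite /= rmorph_sum; apply: eq_bigr => j _.
by rewrite IHs rmorphM rmorphXn.
Qed.

Lemma hsym_coef0 (F : fieldType) (s : seq (pser F)) k :
  hsym s k 0%N = hsym [seq (f : pser F) 0%N | f <- s] k.
Proof.
elim: s k => [|f s IHs]; first by case.
elim=> [|k IHk]; first by rewrite !hsym0.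
rewrite [map _ _]/= in IHk *.
by rewrite !hsymS -IHk -IHs coef_psD coef_psM0.
Qed.

Lemma hsym_over (F : fieldType) (S : subringClosed F) (s : seq (pser F)) k :
  (forall f, f \in s -> ps_over S f) -> ps_over S (hsym s k).
Proof.
elim: s k => [|f s IHs] k Ss; first by case: k => [|k]; [apply: ps_over1 | move=> n; apply: rpred0].
elim: k => [|k IHk]; first by rewrite hsym0; apply: ps_over1.
rewrite hsymS; apply: ps_overD; last by apply: ps_overM => //; apply/Ss/mem_head.
by apply: IHs => g sg; apply: Ss; rewrite inE sg orbT.
Qed.

Section DividedDifferences.
Variable K : fieldType.
Implicit Types (s : seq K) (f : K -> K) (p : {poly K}).

(** The divided difference of f at the points s, in Lagrange form. *)
Definition ddiff f s := \sum_(x <- s) f x / \prod_(y <- s | y != x) (x - y).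

Lemma prod_sub_neq0 s x : \prod_(y <- s | y != x) (x - y) != 0.
Proof.
by rewrite prodf_seq_neq0; apply/allP => y _; rewrite subr_eq0 eq_sym implybb.
Qed.

(** A polynomial of degree less than the number of points is its own Lagrange
    interpolant; both sides are its coefficient of highest possible degree. *)
Lemma ddiff_poly p s : uniq s -> (size p <= size s)%N ->
  ddiff (horner p) s = p`_(size s).-1.
Proof.
move=> Us szp; pose D x := \prod_(y <- s | y != x) (x - y).
pose B x : {poly K} := \prod_(y <- rem x s) ('X - y%:P).
have DB x : x \in s -> B x = \prod_(y <- s | y != x) ('X - y%:P).
  by move=> sx; rewrite /B rem_filter // big_filter.
pose q := \sum_(x <- s) (p.[x] / D x) *: B x.
have szB x : x \in s -> size (B x) = size s.
  by move=> sx; rewrite /B size_prod_XsubC size_rem // prednK //; case: (s) sx.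
have Bx x : x \in s -> (B x).[x] = D x.
  by move=> sx; rewrite DB // horner_prod; apply: eq_bigr => y _; rewrite !hornerE.
have By x y : x \in s -> y \in s -> y != x -> (B x).[y] = 0.
  move=> sx sy neyx; apply/eqP; rewrite DB // horner_prod prodf_seq_eq0.
  by apply/hasP; exists y => //; rewrite neyx !hornerE subrr eqxx.
have Dq : q = p.
  apply/eqP; rewrite -subr_eq0; apply/eqP/(roots_geq_poly_eq0 _ Us).
    apply/allP => x sx; rewrite rootE !hornerE horner_sum big_seq (big_rem x) //= sx.
    rewrite hornerZ Bx // divfK ?prod_sub_neq0 // rem_filter // big_filter_cond.
    rewrite big1 ?addr0 ?subrr // => y /andP[neyx sy].
    by rewrite hornerZ By ?mulr0 // eq_sym.
  rewrite (leq_trans (size_polyD _ _)) // size_polyN geq_max szp andbT.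
  rewrite /q big_seq; elim/big_ind: _ => [|u v su sv|x sx]; first by rewrite size_poly0.
    by rewrite (leq_trans (size_polyD _ _)) // geq_max su.
  by rewrite (leq_trans (size_scale_leq _ _)) // szB.
rewrite -[in RHS]Dq coef_sum /ddiff big_seq [RHS]big_seq; apply: eq_bigr => x sx.
have /monicP := monic_prod_XsubC (rem x s) xpredT id.
rewrite lead_coefE -/(B x) szB // coefZ => ->.
by rewrite mulr1.
Qed.

(** The term at x vanishes, and z - x cancels in the others. *)
Lemma ddiff_mulXsub f x s : uniq (x :: s) ->
  ddiff (fun z => (z - x) * f z) (x :: s) = ddiff f s.
Proof.
case/andP=> sx Us; rewrite /ddiff big_cons subrr !mul0r add0r.
rewrite big_seq [RHS]big_seq; apply: eq_bigr => z sz.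
have nezx : z != x by apply: contraNneq sx => <-.
rewrite big_cons eq_sym nezx invfM mulrACA divff ?mul1r //.
by rewrite subr_eq0.
Qed.

(** Writing z^(e+1) = (z - x) z^e + x z^e gives divided differences of monomials
    the same recursion as [hsymS].  The positivity condition excludes the empty
    set of points in degree 0, where the left side is 0 and the right side 1. *)
Lemma ddiff_expr s k : uniq s -> (0 < size s + k)%N ->
  ddiff (fun x => x ^+ (k + (size s).-1)) s = hsym s k.
Proof.
elim: s k => [|x s IHs] k; first by case: k => // k _ _; rewrite /ddiff big_nil.
move=> Uxs _; have /andP[_ Us] := Uxs; elim: k => [|k IHk].
  have <- : ddiff (horner 'X^(size s)) (x :: s) = hsym (x :: s) 0.
    by rewrite hsym0 ddiff_poly ?size_polyXn // coefXn eqxx.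
  by apply: eq_bigr => z _; rewrite hornerXn.
have Ds : hsym s k.+1 = ddiff (fun z => z ^+ (k + size s)) s.
  case: s {Uxs IHk} IHs Us => [|y s] IHs Us; first by rewrite /ddiff big_nil.
  by rewrite -IHs //= addSnnS.
rewrite hsymS -IHk Ds -(ddiff_mulXsub _ Uxs) /ddiff mulr_sumr -big_split.
apply: eq_bigr => z _ /=; rewrite mulrA -mulrDl; congr (_ / _).
by rewrite addSn exprS; ring.
Qed.

Lemma ddiff_codom (I : finType) (P : I -> K) f : injective P ->
  ddiff f (codom P) = \sum_i f (P i) / \prod_(j | j != i) (P i - P j).
Proof.
move=> injP; rewrite /ddiff big_map big_enum; apply: eq_bigr => i _.
rewrite big_map big_enum_cond /=; congr (_ / _); apply: eq_bigl => j.
by rewrite (inj_eq injP).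
Qed.

End DividedDifferences.

(** * Virtual characters *)

Section Extension.
Variables (K : choiceType) (M : zmodType) (f : K -> M).
Implicit Types (g h : {freeg K}) (s : seq K).

(** The universal property of the free abelian group: the additive extension of
    a function on the generators. *)
Definition fgext g : M := \sum_(x <- dom g) f x *~ coeff x g.

Lemma fgext_widen s g : uniq s -> {subset dom g <= s} ->
  fgext g = \sum_(x <- s) f x *~ coeff x g.
Proof.
move=> Us sgs; rewrite [RHS](bigID (mem (dom g))) /= [X in _ + X]big1 => [|x].
  rewrite addr0 -big_filter; apply/perm_big/uniq_perm; rewrite ?filter_uniq ?uniq_dom //.
  by move=> x; rewrite mem_filter; case: (boolP (x \in dom g)) => //= /sgs ->.
by rewrite mem_dom negbK => /eqP->; rewrite mulr0z.
Qed.

Lemma fgext_is_additive : zmod_morphism fgext.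
Proof.
move=> g h; pose s := undup (dom g ++ dom h); have Us : uniq s by apply: undup_uniq.
rewrite !(@fgext_widen s) //; try by move=> x sx; rewrite mem_undup mem_cat sx ?orbT.
  by rewrite -sumrB; apply: eq_bigr => x _; rewrite coeffB mulrzBr.
by move=> x /domB; rewrite mem_undup.
Qed.
HB.instance Definition _ := GRing.isZmodMorphism.Build {freeg K} M fgext
  fgext_is_additive.

Lemma fgextU x : fgext << x >> = f x.
Proof. by rewrite /fgext domU1 big_seq1 coeffU eqxx. Qed.
End Extension.

Section VcharAlgebra.
Variable d : nat.
Implicit Types (g h : vchar d) (x z : weight d).

Lemma vmulE g h :
  g ** h = fgext (fun x => fgext (fun y => << x + y >>) h) g.
Proof.
apply: eq_bigr => x _; rewrite /fgext mulrz_suml; apply: eq_bigr => y _.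
by rewrite mulrzA_C freegU_mulz intz.
Qed.

Lemma vmul_additivel h : zmod_morphism (fun g => g ** h).
Proof. by move=> g1 g2; rewrite !vmulE raddfB. Qed.

Lemma vmul_additiver g : zmod_morphism (vmul g).
Proof.
move=> h1 h2; rewrite !vmulE /fgext -sumrB; apply: eq_bigr => x _.
by rewrite -/(fgext _ _) raddfB mulrzBl.
Qed.

HB.instance Definition _ g := GRing.isZmodMorphism.Build (vchar d) (vchar d)
  (vmul g) (vmul_additiver g).

(** Multiplication on the right, named in order to carry an additive structure. *)
Definition vmulr h g := g ** h.
HB.instance Definition _ h := GRing.isZmodMorphism.Build (vchar d) (vchar d)
  (vmulr h) (vmul_additivel h).

Lemma vmulBl g1 g2 h : (g1 - g2) ** h = g1 ** h - g2 ** h.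
Proof. exact: vmul_additivel. Qed.
Lemma vmulBr g h1 h2 : g ** (h1 - h2) = g ** h1 - g ** h2.
Proof. exact: vmul_additiver. Qed.
Lemma vmul_suml (I : Type) (r : seq I) (P : pred I) (G : I -> vchar d) h :
  (\sum_(i <- r | P i) G i) ** h = \sum_(i <- r | P i) (G i ** h).
Proof. exact: (raddf_sum (vmulr h)). Qed.
Lemma vmul_sumr (I : Type) (r : seq I) (P : pred I) (G : I -> vchar d) g :
  g ** (\sum_(i <- r | P i) G i) = \sum_(i <- r | P i) (g ** G i).
Proof. exact: (raddf_sum (vmul g)). Qed.

Lemma vmulU x z : vwt x ** vwt z = vwt (x + z).
Proof. by rewrite vmulE !fgextU. Qed.

Lemma vdual_additive : zmod_morphism (@vdual d).
Proof.
have Dvd (g : vchar d) : vdual g = fgext (fun x => << - x >>) g.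
  by apply: eq_bigr => x _; rewrite freegU_mulz intz.
by move=> g h; rewrite !Dvd raddfB.
Qed.
HB.instance Definition _ := GRing.isZmodMorphism.Build (vchar d) (vchar d)
  (@vdual d) vdual_additive.

Lemma vdualU x : vdual (vwt x) = vwt (- x).
Proof. by rewrite /vdual domU1 big_seq1 coeffU eqxx. Qed.

Lemma vdet_additive : zmod_morphism (@vdet d).
Proof. exact: fgext_is_additive. Qed.
HB.instance Definition _ := GRing.isZmodMorphism.Build (vchar d) (weight d)
  (@vdet d) vdet_additive.

Lemma vdetU x : vdet (vwt x) = x. Proof. exact: fgextU. Qed.

Lemma coeff_vwt x z : coeff z (vwt x) = (x == z)%:R.
Proof. by rewrite coeffU mul1r. Qed.

End VcharAlgebra.

(** * Effective characters and their Euler classes *)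

Section Effective.
Variable d : nat.
Implicit Types (s : seq (weight d)).
Local Notation F := (ratfun d).
Local Notation tofrac := FracField.tofrac.

Lemma coeff_effective s x : coeff x (\sum_(z <- s) vwt z) = (count_mem x s)%:Z.
Proof.
rewrite raddf_sum; elim: s => [|z s IHs]; first by rewrite big_nil.
by rewrite big_cons IHs /= PoszD coeff_vwt natz.
Qed.

Lemma dom_effective s : perm_eq (dom (\sum_(z <- s) vwt z)) (undup s).
Proof.
apply: uniq_perm; rewrite ?uniq_dom ?undup_uniq // => x.
by rewrite mem_dom coeff_effective mem_undup eqz_nat -has_pred1 has_count lt0n.
Qed.

Lemma chern_additive : zmod_morphism (@chern d).
Proof.
move=> x z; rewrite /chern -tofracB; congr (tofrac _).
rewrite -sumrB; apply: eq_bigr => i _.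
by rewrite -scalerBl !mxE rmorphB.
Qed.
HB.instance Definition _ := GRing.isZmodMorphism.Build (weight d) (ratfun d)
  (@chern d) chern_additive.

Lemma chernD : {morph @chern d : x z / x + z}. Proof. exact: raddfD. Qed.
Lemma chernB : {morph @chern d : x z / x - z}. Proof. exact: raddfB. Qed.
Lemma chernMn k : {morph @chern d : x / x *+ k}. Proof. exact: raddfMn. Qed.

Lemma chern_eq0 x : (chern x == 0 :> F) = (x == 0).
Proof.
apply/idP/eqP => [|->]; last by rewrite raddf0.
rewrite tofrac_eq0 => /eqP Dx; apply/rowP => i; rewrite mxE.
have := congr1 (mcoeff U_(i)) Dx; rewrite raddf_sum /= mcoeff0 (bigD1 i) //=.
rewrite mcoeffZ mcoeffXU eqxx mulr1 big1 => [|j neji].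
  by rewrite addr0 => /eqP; rewrite intr_eq0 => /eqP.
by rewrite mcoeffZ mcoeffXU (negPf neji) mulr0.
Qed.

Lemma chern_inj : injective (@chern d).
Proof.
by move=> x z /eqP; rewrite -subr_eq0 -raddfB chern_eq0 subr_eq0 => /eqP.
Qed.

Lemma ratfun_char0 n : n.+1%:R != 0 :> F.
Proof.
rewrite -(rmorph_nat (@FracField.tofrac _)) tofrac_eq0.
by rewrite -(rmorph_nat (@mpolyC d rat)) mpolyC_eq0 Num.Theory.pnatr_eq0.
Qed.

(** For an honest representation the exponents are multiplicities, and the product
    over distinct weights unfolds to a product over all weights. *)
Lemma lval_chLambda s : lval (chLambda (\sum_(x <- s) vwt x)) =
  \prod_(x <- s) (1 - tofrac (pexp (- chern x))).
Proof.
rewrite lval_prod (perm_big _ (dom_effective s)) /=.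
rewrite -(big_undup_iterop_count _ _ _ (fun x => 1 - tofrac (pexp (- chern x)))).
apply: eq_bigr => x _; rewrite coeff_effective lval_pown lval_one_sub_expN.
by rewrite Monoid.iteropE; elim: (count _ _) => //= m <-; rewrite exprS.
Qed.

Lemma lnormal_chLambda s : 0 \notin s -> lnormal (chLambda (\sum_(x <- s) vwt x)).
Proof.
move=> s0; apply: lnormal_prod => x.
rewrite (perm_mem (dom_effective s)) mem_undup => sx.
rewrite coeff_effective; apply: lnormal_pown; rewrite /lnormal.
rewrite -[lser _ _]/(todd_den (chern x) 0%N) todd_den_coef0 chern_eq0.
by apply: contraNneq s0 => <-.
Qed.

End Effective.

(** Decides identities between integral combinations of weights, entry by entry. *)
Ltac weight_ring :=
  apply/rowP => ?; rewrite -?scaler_int !mxE ?intz; ring.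

(** * Characters of a one-parameter torus acting with weights t and - t *)

Section OneParameter.
Variables (d : nat) (t : weight d).
Implicit Types (s : seq int) (z : weight d).

Definition tchar s : vchar d := \sum_(c <- s) vwt (t *~ c).

(** The product of (1 - t1)(1 - t2) with the weight c t + z, where t1 = t and
    t2 = - t: minus the discrete Laplacian in c. *)
Definition laplace_char z (c : int) : vchar d :=
  (vwt (t *~ c + z) - vwt (t *~ (c + 1) + z)) -
  (vwt (t *~ (c - 1) + z) - vwt (t *~ c + z)).

Lemma vertex_term s s' z :
  (tchar s' - (vwt 0 - vwt t) ** (vwt 0 - vwt (- t)) ** vdual (tchar s) ** tchar s')
    ** vwt z =
  \sum_(c' <- s') vwt (t *~ c' + z) - \sum_(c <- s) \sum_(c' <- s') laplace_char z (c' - c).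
Proof.
rewrite vmulBl; congr (_ - _).
  by rewrite vmul_suml; apply: eq_bigr => c _; rewrite vmulU.
rewrite [vdual _]raddf_sum [_ ** \sum_(_ <- s) _]vmul_sumr !vmul_suml; apply: eq_bigr => c _.
rewrite vmul_sumr vmul_suml; apply: eq_bigr => c' _.
rewrite /= vdualU !(vmulBl, vmulBr, vmulU) /laplace_char opprB.
have -> : 0 + 0 - t *~ c + t *~ c' + z = t *~ (c' - c) + z by weight_ring.
have -> : t + 0 - t *~ c + t *~ c' + z = t *~ (c' - c + 1) + z by weight_ring.
have -> : 0 - t - t *~ c + t *~ c' + z = t *~ (c' - c - 1) + z by weight_ring.
have -> : t - t - t *~ c + t *~ c' + z = t *~ (c' - c) + z by weight_ring.
by rewrite opprB addrC.
Qed.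

(** The double sum telescopes in both indices: for Q = 1 + t + ... + t^(n-1), it
    says that (1 - t)(1 - t^-1) Q^* Q = (1 - t^n)(1 - t^-n). *)
Lemma sum_laplace_char n z :
  \sum_(i < n) \sum_(j < n) laplace_char z (j%:Z - i%:Z) =
  vwt z *+ 2 - vwt (t *~ n%:Z + z) - vwt (t *~ (- n%:Z) + z).
Proof.
pose u (m : int) := vwt (t *~ m + z).
have tele (f : nat -> vchar d) : \sum_(j < n) (f j.+1 - f j) = f n - f 0%N.
  by rewrite -(big_mkord xpredT (fun j => f j.+1 - f j)) telescope_sumr.
have inner (i : nat) : \sum_(j < n) laplace_char z (j%:Z - i%:Z) =
    (u (n%:Z - i.+1%:Z) - u (n%:Z - i%:Z)) - (u (- i.+1%:Z) - u (- i%:Z)).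
  transitivity (\sum_(j < n) ((u (j.+1%:Z - i.+1%:Z) - u (j.+1%:Z - i%:Z))
      - (u (j%:Z - i.+1%:Z) - u (j%:Z - i%:Z)))).
    apply: eq_bigr => j _; rewrite /laplace_char -/(u _) -/(u _) -/(u _).
    have -> : j%:Z - i%:Z + 1 = j.+1%:Z - i%:Z by lia.
    have -> : j%:Z - i%:Z - 1 = j%:Z - i.+1%:Z by lia.
    by have -> : j.+1%:Z - i.+1%:Z = j%:Z - i%:Z by lia.
  by rewrite (tele (fun j : nat => u (j%:Z - i.+1%:Z) - u (j%:Z - i%:Z))) !sub0r.
under eq_bigr => i _ do rewrite inner.
rewrite sumrB (tele (fun i : nat => u (n%:Z - i%:Z))) (tele (fun i : nat => u (- i%:Z))).
rewrite subrr subr0 oppr0 /u mulr0z add0r mulr2n opprB.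
by rewrite [LHS]addrACA addrA.
Qed.
End OneParameter.

(** * An inequality for multisets of integers *)

Section ContentInequality.
Variable s : seq int.

Definition multz (z : int) : int := \sum_(c <- s) (c == z)%:R.

Lemma sum_by_multz (M : nat) (g : int -> int) :
  {in s, forall c, - M%:Z <= c < M%:Z} ->
  \sum_(c <- s) g c = \sum_(i < M + M) multz (i%:Z - M%:Z) * g (i%:Z - M%:Z).
Proof.
move=> sM; under [RHS]eq_bigr => i _ do rewrite mulr_suml.
rewrite exchange_big; apply: eq_big_seq => c /sM/andP[ltMc ltcM] /=.
have lt_c : (absz (c + M%:Z)%R < M + M)%N by lia.
rewrite (bigD1 (Ordinal lt_c)) //= big1 => [|i].
  by have -> : (absz (c + M%:Z))%:Z - M%:Z = c by [lia]; rewrite eqxx mul1r addr0.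
rewrite -val_eqE /= => neic; case: eqP => [Dc|]; last by rewrite mul0r.
by case/eqP: neic; lia.
Qed.

(** The trivial-weight part of [laplace_char]. *)
Definition laplacez (c : int) : int :=
  (c == 0)%:R *+ 2 - (c == -1)%:R - (c == 1)%:R.

Lemma sqr_ge_self (x : int) : x <= x ^+ 2.
Proof. by rewrite expr2; nia. Qed.

(** Summation by parts turns the right side into the sum over z of
    (multz (z + 1) - multz z)^2.  As a square of an integer is at least that
    integer up to sign, the part of this sum below 0 and the part above 0 are each
    at least multz 0, by telescoping. *)
Lemma laplacez_sum_ge : multz 0 *+ 2 <= \sum_(c <- s) \sum_(c' <- s) laplacez (c' - c).
Proof.
(* A bound beyond which all multiplicities vanish. *)
pose M := (\sum_(c <- s) absz c)%N.+1.
have sM : {in s, forall c, - M%:Z < c < M%:Z}.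
  move=> c sc; have : (absz c <= \sum_(c <- s) absz c)%N by rewrite (big_rem c) //= leq_addr.
  by rewrite /M; lia.
have FM z : (z <= - M%:Z) || (M%:Z <= z) -> multz z = 0.
  move=> zM; rewrite /multz big_seq big1 // => c /sM cM.
  by case: eqP => // Dc; move: zM cM; rewrite Dc; lia.
pose f (i : nat) := multz (i%:Z - M%:Z).
pose e (i : nat) := f i.+1 - f i.
have f0 : f 0%N = 0 by rewrite /f FM //; lia.
have f2M : f (M + M)%N = 0 by rewrite /f FM //; lia.
have -> : \sum_(c <- s) \sum_(c' <- s) laplacez (c' - c) = \sum_(0 <= i < M + M) e i ^+ 2.
  have -> : \sum_(c <- s) \sum_(c' <- s) laplacez (c' - c) =
      \sum_(c <- s) (multz c *+ 2 - multz (c - 1) - multz (c + 1)).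
    apply: eq_bigr => c _; rewrite /multz -sumrMnl -!sumrB; apply: eq_bigr => c' _.
    rewrite /laplacez; do !congr (_ - _); do ?congr (_ *+ 2);
      by congr (nat_of_bool _)%:R; apply/eqP/eqP; lia.
  rewrite (@sum_by_multz M) => [|c /sM]; last by lia.
  rewrite big_mkord.
  pose h (i : nat) := f i * (f i - multz (i%:Z - M%:Z - 1)).
  have -> : \sum_(i < M + M) e i ^+ 2 = \sum_(i < M + M) e i ^+ 2 - (h (M + M)%N - h 0%N).
    by rewrite /h f0 f2M !mul0r !subr0.
  rewrite -(telescope_sumr h (leq0n _)) big_mkord -sumrB; apply: eq_bigr => i _.
  rewrite /h /e /f.
  have -> : i.+1%:Z - M%:Z - 1 = i%:Z - M%:Z by lia.
  have -> : i.+1%:Z - M%:Z = i%:Z - M%:Z + 1 by lia.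
  by ring.
have Df : f M = multz 0 by rewrite /f subrr.
rewrite (@big_cat_nat _ _ _ M) ?leq_addr //= mulr2n; apply: lerD.
  have -> : multz 0 = f M - f 0%N by rewrite f0 subr0.
  rewrite -telescope_sumr //.
  by apply: ler_sum => i _; apply: sqr_ge_self.
have -> : multz 0 = - (f (M + M)%N - f M) by rewrite f2M Df sub0r opprK.
rewrite -telescope_sumr ?leq_addr // -sumrN.
by apply: ler_sum => i _; rewrite -sqrrN sqr_ge_self.
Qed.
End ContentInequality.

(** * The trivial weight at an arbitrary fixed point *)

Section Contents.
Variable n : nat.
Implicit Type rho : ptn n.

(** Since t2 = - t1, the weight of the box (i, j) is (i - j) t1. *)
Definition contents rho : seq int :=
  [seq i%:Z - j%:Z | i : 'I_n <- enum 'I_n, j <- iota 0 (rho i)].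

Lemma sum_contents (M : nmodType) (G : int -> M) rho :
  \sum_(c <- contents rho) G c =
  \sum_(i < n) \sum_(j < n | (j < rho i)%N) G (i%:Z - j%:Z).
Proof.
rewrite big_allpairs_dep big_enum; apply: eq_bigr => i _.
rewrite -(big_ord_widen n (fun j : nat => G (i%:Z - j%:Z))); last by rewrite -ltnS.
by rewrite -(big_mkord xpredT (fun j : nat => G (i%:Z - j%:Z))) /index_iota subn0.
Qed.

Lemma multz0_contents rho :
  multz (contents rho) 0 = \sum_(i < n) (i < rho i)%N%:R.
Proof.
rewrite /multz sum_contents; apply: eq_bigr => i _.
rewrite big_mkcond (bigD1 i) //= subrr eqxx big1 ?addr0 => [|j neji].
  by case: ifP.
by case: ifP => // _; rewrite subr_eq0 eqz_nat val_eqE eq_sym (negPf neji).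
Qed.

End Contents.

Section FixedPoints.
Variables (N a b n : nat).
Local Notation t1 := (t1 N a b).
Local Notation y := (@y N a b).
Implicit Type p : {ffun 'I_N -> ptn n}.

Lemma Q_contents p k : Q a b p k = tchar t1 (contents (p k)).
Proof.
rewrite /tchar sum_contents; apply: eq_bigr => i _; apply: eq_bigr => j _.
by rewrite mulrzBr mulNrn opprK addrC.
Qed.

Lemma Tred_contents p : Tred a b p = vwt 0 + \sum_k \sum_l
  (\sum_(c' <- contents (p l)) vwt (t1 *~ c' + (- y k + y l)) -
   \sum_(c <- contents (p k)) \sum_(c' <- contents (p l))
     laplace_char t1 (- y k + y l) (c' - c)).
Proof.
congr (_ + _); apply: eq_bigr => k _; apply: eq_bigr => l _.
by rewrite !Q_contents vertex_term.
Qed.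

Lemma t1_ilam : t1 0 (ilam N a b) = 1. Proof. by rewrite mxE !eqxx. Qed.
Lemma y_ilam k : y k 0 (ilam N a b) = 0.
Proof. by rewrite mxE (inj_eq (@lshift_inj _ _)) eq_lrshift. Qed.
Lemma t1_im k : t1 0 (im a b k) = 0.
Proof. by rewrite mxE (inj_eq (@lshift_inj _ _)) eq_rlshift. Qed.
Lemma y_im k l : y k 0 (im a b l) = (k == l)%:R.
Proof.
by rewrite mxE eqxx (inj_eq (@lshift_inj _ _)) (inj_eq (@rshift_inj _ _)) eq_sym.
Qed.

Lemma t1_y_coord c k l j :
  (t1 *~ c + (- y k + y l)) 0 j = c * t1 0 j - y k 0 j + y l 0 j.
Proof. by rewrite -scaler_int !mxE intz addrA. Qed.

Lemma t1_y_eq0 c k l : (t1 *~ c + (- y k + y l) == 0) = (c == 0) && (k == l).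
Proof.
apply/eqP/andP => [/rowP E|[/eqP-> /eqP->]]; last by rewrite mulr0z add0r addNr.
split.
  have := E (ilam N a b); rewrite t1_y_coord t1_ilam !y_ilam mxE.
  by rewrite mulr1 subr0 addr0 => ->.
have := E (im a b k); rewrite t1_y_coord t1_im !y_im mxE eqxx mulr0 add0r [l == k]eq_sym.
by case: eqP.
Qed.

Lemma coeff0_laplace_char c k l :
  coeff 0 (laplace_char t1 (- y k + y l) c) = laplacez c *+ (k == l).
Proof.
rewrite /laplace_char !coeffB !coeff_vwt !t1_y_eq0 /laplacez.
have -> : (c + 1 == 0) = (c == -1) by apply/eqP/eqP; lia.
have -> : (c - 1 == 0) = (c == 1) by apply/eqP/eqP; lia.
by case: (k == l); rewrite ?andbT ?andbF ?mulr1n ?mulr0n //; ring.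
Qed.

(** Terms mixing two different partitions carry a weight y_l - y_k and cannot be
    trivial; for the others, [laplacez_sum_ge] applies. *)
Lemma coeff0_Tred_le p :
  coeff 0 (Tred a b p) <= 1 - \sum_k multz (contents (p k)) 0.
Proof.
rewrite Tred_contents coeffD coeff_vwt eqxx lerD2l -sumrN raddf_sum.
apply: ler_sum => k _; rewrite raddf_sum (bigD1 k) //= [X in _ + X]big1 => [|l nelk].
  rewrite addr0 coeffB; have := laplacez_sum_ge (contents (p k)).
  have -> : coeff 0 (\sum_(c' <- contents (p k)) vwt (t1 *~ c' + (- y k + y k))) =
      multz (contents (p k)) 0.
    rewrite raddf_sum; apply: eq_bigr => c _ /=.
    by rewrite coeff_vwt t1_y_eq0 eqxx andbT.
  have -> : coeff 0 (\sum_(c <- contents (p k)) \sum_(c' <- contents (p k))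
      laplace_char t1 (- y k + y k) (c' - c)) =
      \sum_(c <- contents (p k)) \sum_(c' <- contents (p k)) laplacez (c' - c).
    rewrite raddf_sum; apply: eq_bigr => c _; rewrite /= raddf_sum.
    by apply: eq_bigr => c' _ /=; rewrite coeff0_laplace_char eqxx.
  by rewrite mulr2n; lia.
rewrite coeffB !raddf_sum big1 => [|c _]; last first.
  by rewrite /= coeff_vwt t1_y_eq0 [k == l]eq_sym (negPf nelk) andbF.
rewrite add0r big1 // => c _; rewrite /= raddf_sum big1 ?oppr0 // => c' _ /=.
by rewrite coeff0_laplace_char [k == l]eq_sym (negPf nelk).
Qed.

End FixedPoints.

(** * Hooks *)

Section Hooks.
Variables (N m : nat).
Local Notation n := m.+1.
Implicit Types (l : 'I_n) (rho : ptn n) (p : {ffun 'I_N -> ptn n}).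

(** The hook of n boxes with leg length l: first row n - l, then l rows of
    length 1. *)
Definition hook_ptn l : ptn n :=
  [ffun i : 'I_n => inord (if i == ord0 then n - l else (i <= l))%N].

Lemma hook_ptnE l i :
  hook_ptn l i = (if i == ord0 then n - l else (i <= l))%N :> nat.
Proof.
rewrite ffunE inordK //; case: ifP => _; first by rewrite ltnS leq_subr.
by case: (i <= l)%N.
Qed.

(** The contents of a hook are l, l - 1, ..., l - n + 1, each occurring once. *)
Lemma sum_contents_hook (M : nmodType) (G : int -> M) l :
  \sum_(c <- contents (hook_ptn l)) G c = \sum_(c < n) G (l%:Z - c%:Z).
Proof.
have lln : (l <= n)%N by apply: ltnW.
rewrite sum_contents big_ord_recl [LHS]addrC.
rewrite -[RHS](big_mkord xpredT (fun c : nat => G (l%:Z - c%:Z))).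
rewrite (@big_cat_nat _ _ _ l) //=; congr (_ + _).
  rewrite big_nat_rev add0n big_mkord.
  rewrite (big_ord_widen m (fun c : nat => G (l%:Z - (l - c.+1)%N%:Z))); last by rewrite -ltnS.
  rewrite [RHS]big_mkcond; apply: eq_bigr => i _.
  under eq_bigl => j do rewrite hook_ptnE /= /bump add1n.
  case: ifP => ltil; last by rewrite big1 // => j; case: (j : nat).
  rewrite (bigD1 ord0) //= big1 ?addr0 => [|j]; last by case: j => -[].
  by congr G; rewrite /bump; lia.
rewrite -{1}[l : nat]add0n big_addn big_mkord.
rewrite (big_ord_widen n (fun c : nat => G (l%:Z - (c + l)%N%:Z))) ?leq_subr //.
apply: eq_big => j; first by rewrite hook_ptnE.
by move=> _; congr G; rewrite /=; lia.
Qed.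

Lemma size_contents rho : (\sum_i rho i)%N = size (contents rho).
Proof.
rewrite -sum1_size (sum_contents (fun=> 1%N)); apply: eq_bigr => i _.
rewrite -(big_ord_widen n (fun=> 1%N)); last by rewrite -ltnS.
by rewrite sum1_card card_ord.
Qed.

Lemma size_contents_hook l : size (contents (hook_ptn l)) = n.
Proof. by rewrite -sum1_size (sum_contents_hook (fun=> 1%N)) sum1_card card_ord. Qed.

Lemma is_ptnP rho :
  reflect (forall i j : 'I_n, (i <= j)%N -> (rho j <= rho i)%N) (is_ptn rho).
Proof.
apply: (iffP forallP) => [h i j | h i]; first by move/forallP/(_ j)/implyP: (h i).
by apply/forallP => j; apply/implyP/h.
Qed.

Lemma is_ptn_hook l : is_ptn (hook_ptn l).
Proof.
apply/is_ptnP => i j leij; rewrite !hook_ptnE -!val_eqE /=.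
by have := ltn_ord l; case: eqP; case: eqP; lia.
Qed.

Definition hook_tuple (kl : 'I_N * 'I_n) : {ffun 'I_N -> ptn n} :=
  [ffun k => if k == kl.1 then hook_ptn kl.2 else [ffun => ord0]].

Lemma hook_tuple_inj : injective hook_tuple.
Proof.
move=> [k l] [k' l'] /ffunP E; have := E k; rewrite !ffunE eqxx /=.
case: eqP => [<-|_] /ffunP /(_ ord0) /(congr1 (@nat_of_ord _)).
  rewrite !hook_ptnE /= => E0; congr (_, _); apply: val_inj => /=.
  by have := ltn_ord l; have := ltn_ord l'; lia.
by rewrite hook_ptnE !ffunE /= => E0; have := ltn_ord l; lia.
Qed.

Lemma contents_empty (rho : ptn n) : (forall i, rho i = 0 :> nat) -> contents rho = [::].
Proof.
by move=> rho0; apply: size0nil; rewrite -size_contents big1.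
Qed.

Lemma is_ptn_tuple_hook kl : is_ptn_tuple (hook_tuple kl).
Proof.
apply/andP; split.
  apply/forallP => k; rewrite ffunE; case: ifP => _; first exact: is_ptn_hook.
  by apply/is_ptnP => i j _; rewrite !ffunE.
rewrite (bigD1 kl.1) //= [X in (_ + X)%N]big1 => [|k nek].
  by rewrite size_contents ffunE eqxx size_contents_hook addn0.
by rewrite big1 // => i _; rewrite !ffunE (negPf nek) ffunE.
Qed.

(** The size of a hook, before it is known to have n boxes. *)
Lemma sum_column (x j : nat) : (0 < j <= n)%N ->
  (\sum_(i < n) (if i == ord0 then x else (i < j)) = x + j.-1)%N.
Proof.
case/andP; case: j => // j _ lejn; rewrite big_ord_recl eqxx; congr (_ + _)%N.
rewrite -big_mkcond /= -[RHS]card_ord -sum1_card.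
by rewrite [RHS](big_ord_widen m (fun=> 1%N)).
Qed.

(** At most one diagonal box means that the second row has length at most 1; the
    remaining freedom is the length of the first row. *)
Lemma hook_of_durfee rho : is_ptn rho -> (\sum_i rho i)%N = n ->
  (\sum_(i < n) (i < rho i) <= 1)%N -> exists l, rho = hook_ptn l.
Proof.
move/is_ptnP=> rhoP rhon D1.
have rho0 : (0 < rho ord0)%N.
  rewrite lt0n; apply: contra_eq_neq rhon => rho0.
  rewrite big1 // => i _; apply/eqP; rewrite -leqn0 -rho0.
  exact: rhoP.
have rho1 i : i != ord0 -> (rho i <= 1)%N.
  move=> nei0; rewrite leqNgt; apply: contraL D1 => rhoi; rewrite -ltnNge.
  have lt1m : (1 < n)%N by move: (ltn_ord i) nei0; rewrite -val_eqE /=; lia.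
  rewrite (bigD1 ord0) //= rho0 (bigD1 (Ordinal lt1m)) //=.
  have -> // : (1 < rho (Ordinal lt1m))%N.
  by apply: (leq_trans rhoi); apply: rhoP; rewrite lt0n.
have lt_l : (n - rho ord0 < n)%N by lia.
exists (Ordinal lt_l); apply/ffunP => i; apply: ord_inj; rewrite hook_ptnE /=.
have ltr0 := ltn_ord (rho ord0).
case: eqP => [->|/eqP nei0]; first by lia.
have i0 : (0 < i)%N by rewrite lt0n.
case: (posnP (rho i)) => [ri0 | ri0].
  have : (\sum_i rho i <= rho ord0 + i.-1)%N.
    rewrite -(@sum_column _ i); last by rewrite i0 ltnW.
    apply: leq_sum => j _.
    case: eqP => [->//|/eqP nej0]; case: ltnP => [_|leij]; first exact: rho1.
    by have := rhoP _ _ leij; rewrite ri0.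
  by rewrite rhon; lia.
have : (rho ord0 + i.+1.-1 <= \sum_i rho i)%N.
  rewrite -(@sum_column _ i.+1); last exact: ltn_ord.
  apply: leq_sum => j _.
  case: eqP => [->//|_]; case: ltnP => // leji.
  by rewrite (leq_trans ri0) // rhoP.
by rewrite rhon; have := rho1 i nei0; lia.
Qed.

(** Every nonempty partition has a diagonal box, so there is exactly one of
    them. *)
Lemma hook_tuple_of_durfee p : is_ptn_tuple p ->
  \sum_k multz (contents (p k)) 0 <= 1 -> exists kl, p = hook_tuple kl.
Proof.
case/andP=> /forallP ptnp /eqP pn.
pose D k := (\sum_(i < n) (i < p k i))%N.
have -> : \sum_k multz (contents (p k)) 0 = (\sum_k D k)%N%:Z.
  rewrite (big_morph Posz PoszD (erefl _)); apply: eq_bigr => k _.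
  by rewrite multz0_contents -natr_sum natz.
rewrite lez_nat => D1.
have Dgt0 k i : (0 < p k i)%N -> (0 < D k)%N.
  move=> pki; have /is_ptnP ptnk := ptnp k.
  have pk0 : (0 < p k ord0)%N by rewrite (leq_trans pki) // ptnk.
  by rewrite /D (bigD1 ord0) //= pk0.
have [k pk] : exists k, (0 < \sum_i p k i)%N.
  apply/existsP; apply: contra_eqT pn; rewrite negb_exists => /forallP p0.
  by rewrite big1 // => k _; apply/eqP; rewrite -leqn0 leqNgt p0.
have Dk : (0 < D k)%N.
  have [i pki] : exists i, (0 < p k i)%N.
    apply/existsP; apply: contraLR pk; rewrite negb_exists => /forallP p0.
    by rewrite -leqNgt leqn0; apply/eqP/big1 => i _; have := p0 i; case: (p k i : nat).
  exact: Dgt0 pki.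
have p0 k' i : k' != k -> p k' i = 0 :> nat.
  move=> nek; apply/eqP; rewrite -leqn0 leqNgt; apply: contraL D1 => /Dgt0 Dk'.
  by rewrite -ltnNge (bigD1 k) //= (bigD1 k') //=; lia.
have pkn : (\sum_i p k i)%N = n.
  rewrite -[RHS]pn (bigD1 k) //= [X in (_ + X)%N]big1 ?addn0 // => k' nek.
  by rewrite big1 // => i _; apply: p0.
have [] := hook_of_durfee (ptnp k) pkn.
  by apply: leq_trans D1; rewrite (bigD1 k) //= leq_addr.
move=> l Dl; exists (k, l); apply/ffunP => k'; rewrite ffunE /=.
case: eqP => [->|/eqP nek] //; apply/ffunP => i; apply: ord_inj.
by rewrite ffunE p0.
Qed.

End Hooks.

(** * Characters at the hook fixed points *)

Section HookCharacters.
Variables (N a b m : nat).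
Local Notation n := m.+1.
Local Notation t1 := (t1 N a b).
Local Notation y := (@y N a b).
Implicit Types (kl j : 'I_N * 'I_n).

(** The points of the interpolation problem: the weight differences at a hook are
    the differences from its own point to all the others. *)
Definition hook_point j : weight (rk N a b) := y j.1 + t1 *~ j.2%:Z.

Lemma hook_point_inj : injective hook_point.
Proof.
move=> [k l] [k' l'] /eqP; rewrite -subr_eq0 /hook_point /=.
have -> : y k + t1 *~ l - (y k' + t1 *~ l') = t1 *~ (l%:Z - l'%:Z) + (- y k' + y k).
  by weight_ring.
rewrite t1_y_eq0 subr_eq0 eqz_nat => /andP[/eqP/ord_inj-> /eqP->].
by [].
Qed.

Lemma contents_hook_tuple kl k :
  contents (hook_tuple kl k) = if k == kl.1 then contents (hook_ptn kl.2) else [::].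
Proof.
rewrite ffunE; case: eqP => // _; apply: contents_empty => i.
by rewrite ffunE.
Qed.

(** The hook paired with every y_k' gives all the differences of points, including
    the zero one; its pairing with itself contributes n t1 and - n t1 and removes
    two trivial weights, one of which offsets the 1 of the reduction, the other the
    zero difference. *)
Lemma Tred_hook kl : Tred a b (hook_tuple kl) =
  vwt (t1 *~ n%:Z) + vwt (t1 *~ - n%:Z) + \sum_(j | j != kl) vwt (hook_point kl - hook_point j).
Proof.
case: kl => k l; rewrite Tred_contents exchange_big (bigD1 k) //=.
rewrite [X in _ + (_ + X)]big1 ?addr0 => [|l' nel']; last first.
  rewrite big1 // => k' _; rewrite [contents (_ l')]contents_hook_tuple (negPf nel').
  by rewrite big_nil sub0r big1 ?oppr0 // => c _; rewrite big_nil.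
rewrite [contents (_ k)]contents_hook_tuple eqxx /= sumrB.
have -> : \sum_(k' < N) \sum_(c' <- contents (hook_ptn l))
    vwt (t1 *~ c' + (- y k' + y k)) = \sum_j vwt (hook_point (k, l) - hook_point j).
  rewrite -(pair_big xpredT xpredT (fun k' c => vwt (hook_point (k, l) - hook_point (k', c)))) /=.
  apply: eq_bigr => k' _; rewrite sum_contents_hook; apply: eq_bigr => c _.
  by congr vwt; rewrite /hook_point /=; weight_ring.
rewrite (bigD1 k) //= [X in _ - (_ + X)]big1 ?addr0 => [|k' nek']; last first.
  by rewrite contents_hook_tuple (negPf nek') big_nil.
rewrite contents_hook_tuple eqxx addNr /=.
have -> : \sum_(c <- contents (hook_ptn l)) \sum_(c' <- contents (hook_ptn l))
    laplace_char t1 0 (c' - c) = vwt 0 *+ 2 - vwt (t1 *~ n%:Z) - vwt (t1 *~ (- n%:Z)).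
  rewrite sum_contents_hook; under eq_bigr => i _ do rewrite sum_contents_hook.
  rewrite exchange_big -[t1 *~ n]addr0 -[t1 *~ - _]addr0 -sum_laplace_char.
  apply: eq_bigr => i _; apply: eq_bigr => j _; congr laplace_char; lia.
rewrite (bigD1 (k, l)) //= subrr mulr2n !opprB.
set S := \sum_(_ | _) _; set A := vwt _; set B := vwt (_ *~ n); set C := vwt (_ *~ - _).
by rewrite addrA [A + (A + S)]addrA [C + _]addrA addrC addrA subrK [C + B]addrC.
Qed.

Hypothesis (r : nat) (Dr : a = (b + r)%N).

Lemma vdet_alphaM z : vdet (alpha N a b ** vwt z) = vdet (alpha N a b) + z *+ r.
Proof.
have Ds (I : finType) (f : I -> weight (rk N a b)) :
    vdet ((\sum_i vwt (f i)) ** vwt z) = vdet (\sum_i vwt (f i)) + z *+ #|I|.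
  rewrite vmul_suml !raddf_sum -sum1_card -sumrMnr -big_split; apply: eq_bigr => i _.
  by rewrite /= vmulU !vdetU mulr1n.
have [leba Er] : (b <= a)%N /\ r = (a - b)%N by rewrite Dr leq_addr addKn.
by rewrite vmulBl !raddfB /= !Ds !card_ord opprD addrACA Er mulrnBr.
Qed.

Lemma vdet_alpha_taut_hook kl : vdet (alpha_taut a b (hook_tuple kl)) =
  vdet (alpha N a b) *+ n + (hook_point kl *+ n - t1 *+ 'C(n, 2)) *+ r.
Proof.
case: kl => k l; rewrite /alpha_taut (bigD1 k) //= big1 => [|k' nek']; last first.
  by rewrite Q_contents contents_hook_tuple (negPf nek') /tchar big_nil raddf0.
rewrite addr0 Q_contents contents_hook_tuple eqxx /tchar sum_contents_hook vmul_sumr.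
have alphaA x z : alpha N a b ** vwt x ** vwt z = alpha N a b ** vwt (x + z).
  have sumA (I : finType) (f : I -> weight (rk N a b)) :
      (\sum_i vwt (f i)) ** vwt x ** vwt z = (\sum_i vwt (f i)) ** vwt (x + z).
    rewrite [_ ** vwt x]vmul_suml vmul_suml vmul_suml.
    by apply: eq_bigr => i _; rewrite !vmulU addrA.
  by rewrite [_ ** vwt x]vmulBl vmulBl vmulBl !sumA.
rewrite raddf_sum; under eq_bigr => c _ do rewrite /= alphaA vdet_alphaM.
rewrite big_split sumr_const card_ord sumrMnl /=; congr (_ + _ *+ r).
have -> : hook_point (k, l) *+ n = \sum_(c < n) hook_point (k, l) by rewrite sumr_const card_ord.
rewrite -bin2_sum big_mkord -sumrMnr -sumrB.
by apply: eq_bigr => c _; rewrite /hook_point /= -[t1 *+ c]/(t1 *~ c%:Z); weight_ring.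
Qed.
End HookCharacters.

Lemma one_sub_ratio (K : fieldType) (e p q : K) : p != 0 -> e * p = q ->
  1 - e = (p - q) / p.
Proof. by move=> p0 <-; apply: (mulIf p0); rewrite divfK // mulrBl mul1r. Qed.

Lemma regroup_exponents (K : fieldType) (x q u v w : K) (k l : nat) :
  x * q ^+ k / (u * (v * (w / q ^+ l))) = x * (q ^+ (k + l) / w) / (u * v).
Proof. by rewrite exprD !invfM invrK; ring. Qed.

(** * The sum over hooks *)

Section HookSum.
Variables (N a b m : nat).
Local Notation n := m.+1.
Local Notation d := (rk N a b).
Local Notation F := (ratfun d).
Local Notation tofrac := FracField.tofrac.
Local Notation t1 := (t1 N a b).
Implicit Types (kl j : 'I_N * 'I_n).

Definition hook_weights kl : seq (weight d) :=
  [:: t1 *~ n%:Z, t1 *~ - n%:Z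
    & [seq hook_point a b kl - hook_point a b j | j <- enum (predC1 kl)]].

Lemma Tred_hook_weights kl :
  Tred a b (hook_tuple kl) = \sum_(x <- hook_weights kl) vwt x.
Proof. by rewrite Tred_hook !big_cons big_map -big_enum addrA. Qed.

Lemma t1_mulz_eq0 (c : int) : (t1 *~ c == 0) = (c == 0).
Proof.
apply/eqP/eqP => [/rowP/(_ (ilam N a b))|->]; last by rewrite mulr0z.
by rewrite -scaler_int !mxE !eqxx intz mulr1.
Qed.

Lemma hook_weights_neq0 kl : 0 \notin hook_weights kl.
Proof.
rewrite !inE !negb_or ![0 == _]eq_sym !t1_mulz_eq0 oppr_eq0 /=.
apply/mapP => -[j]; rewrite mem_enum => nej /esym/eqP.
by rewrite subr_eq0 => /eqP/hook_point_inj Ekl; rewrite Ekl inE /= eqxx in nej.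
Qed.

(** All the other tuples have a negative multiplicity of the trivial weight. *)
Lemma Vred0_hooks :
  Vred0 N a b n = \sum_kl lcoef0 (contribution a b (@hook_tuple N m kl)).
Proof.
pose hooks := [set @hook_tuple N m kl | kl : 'I_N * 'I_n].
rewrite /Vred0 (bigID (fun p => p \in hooks)) /= addrC.
rewrite big1 ?add0r => [|p /andP[ptnp hookp]]; last first.
  rewrite /contribution0 ifT //; apply: le_lt_trans (coeff0_Tred_le _ _ _) _.
  rewrite subr_lt0 ltNge; apply: contra hookp => /(hook_tuple_of_durfee ptnp)[kl ->].
  exact: imset_f.
rewrite (eq_bigl (fun p => p \in hooks)) => [|p]; last first.
  by rewrite andb_idl // => /imsetP[kl _ ->]; apply: is_ptn_tuple_hook.
rewrite big_imset /=; last by move=> kl kl' _ _; apply: hook_tuple_inj.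
apply: eq_bigr => kl _; rewrite /contribution0 Tred_hook_weights coeff_effective.
by rewrite (count_memPn _) ?ltxx ?hook_weights_neq0 // -Tred_hook_weights.
Qed.

Hypothesis (r : nat) (Dr : a = (b + r)%N).

Definition hook_root j : pser F := pexp (chern (hook_point a b j)).
(** The part of the exponent that depends on alpha, n c_1(alpha). *)
Definition alpha_exponent : F := chern (vdet (alpha N a b)) *+ n.
(** What remains of r times the sum of the box weights of a hook once r n times its
    point is taken out; it is the same for all hooks. *)
Definition content_exponent : F := - chern t1 *+ 'C(n, 2) *+ r.

Local Notation E c := (1 - tofrac (pexp (- chern (t1 *~ c)))).

(** Each factor 1 - exp(x_j - x_i) equals (p_i - p_j) / p_i; the N n - 1
    denominators p_i raise the exponent of p_i to the one of [ddiff_expr]. *)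
Lemma lval_contribution kl : lval (contribution a b (hook_tuple kl)) =
  tofrac (pexp alpha_exponent * pexp content_exponent) *
  (tofrac (hook_root kl) ^+ (r * n + (N * n).-1) /
     \prod_(j | j != kl) (tofrac (hook_root kl) - tofrac (hook_root j))) /
  (E n%:Z * E (- n%:Z)).
Proof.
have char0 := @ratfun_char0 d.
have root_neq0 j : tofrac (hook_root j) != 0.
  rewrite tofrac_eq0; apply/eqP => /(congr1 (fun f : pser F => f 0%N))/eqP.
  by rewrite /hook_root pexp_coef0 coef_ps0 oner_eq0.
have DE j : 1 - tofrac (pexp (- chern (hook_point a b kl - hook_point a b j))) =
    (tofrac (hook_root kl) - tofrac (hook_root j)) / tofrac (hook_root kl).
  apply: (one_sub_ratio (root_neq0 kl)); rewrite -tofracM; congr (tofrac _).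
  by rewrite /hook_root -pexpD // chernB opprB subrK.
rewrite lvalM lvalV; last first.
  by rewrite Tred_hook_weights; apply/lnormal_chLambda/hook_weights_neq0.
rewrite Tred_hook_weights lval_chLambda lval_exp (vdet_alpha_taut_hook Dr).
have -> : chern (vdet (alpha N a b) *+ n + (hook_point a b kl *+ n - t1 *+ 'C(n, 2)) *+ r) =
    alpha_exponent + content_exponent + chern (hook_point a b kl) *+ (r * n).
  rewrite chernD 2!chernMn chernB 2!chernMn /alpha_exponent /content_exponent.
  rewrite mulrnBl -mulrnA [(r * n)%N]mulnC.
  by rewrite -addrA [_ + chern _ *+ (_ * _)]addrC !mulNrn.
have -> : pexp (alpha_exponent + content_exponent + chern (hook_point a b kl) *+ (r * n)) =
    pexp alpha_exponent * pexp content_exponent * hook_root kl ^+ (r * n).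
  rewrite [LHS]pexpD // [pexp (_ + _)]pexpD //; congr (_ * _); exact: pexpMn.
rewrite [tofrac (_ * _ ^+ _)]tofracM tofracXn.
rewrite /hook_weights !big_cons big_map big_enum (eq_bigr _ (fun j _ => DE j)).
rewrite prodf_div prodr_const cardC1 card_prod !card_ord.
exact: regroup_exponents.
Qed.
End HookSum.

Lemma regroup_quotient (K : fieldType) (e1 e2 h x c1 c2 u1 u2 : K) :
  e1 * e2 * h / (x * (c1 * u1) * (x * (c2 * u2))) =
  x ^- 2 * (e1 * ((c1 * c2)^-1 * (e2 * h * (u1 * u2)^-1))).
Proof. by rewrite expr2 !invfM; ring. Qed.

Lemma regroup_quadratic (K : fieldType) (w0 w1 w2 c h t : K) :
  - t^-1 * w2 + c * (- t^-1 * w1) + c ^+ 2 / h * (- t^-1 * w0) =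
  - (w2 + c * w1 + c ^+ 2 / h * w0) / t.
Proof. by ring. Qed.

Lemma neg_square_cancel (K : fieldType) (x : K) : x != 0 ->
  - x ^- 2 * (x * - x) = 1.
Proof. by move=> x0; rewrite mulrN mulNr mulrN opprK -expr2 mulVf // expf_neq0. Qed.

Section Scaling.
Variable F : fieldType.

Definition psC (c : F) : pser F := PSer (fun n => c * (n == 0%N)%:R).

Lemma coef_psCM c (f : pser F) n : (psC c * f) n = c * f n.
Proof.
rewrite coef_psM big_ord_recl subn0 [psC c _]/= mulr1 big1 ?addr0 // => i _.
by rewrite /= mulr0 mul0r.
Qed.

Lemma psCM c c' : psC c * psC c' = psC (c * c').
Proof. by apply: pserP => n; rewrite coef_psCM /= mulrA. Qed.

Lemma psC1 : psC 1 = 1. Proof. by apply: pserP => n; rewrite /= mul1r. Qed.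

(** The series (1 - exp(- b x)) / (b x), the inverse of the Todd series. *)
Definition todd_inv (x : F) : pser F :=
  PSer (fun n => (-1) ^+ n * x ^+ n / (n.+1`!)%:R).

Lemma todd_den_scale x : todd_den x = psC x * todd_inv x.
Proof. by apply: pserP => n; rewrite coef_psCM todd_denE /= exprS; ring. Qed.

Lemma todd_inv0 x : todd_inv x 0%N = 1.
Proof. by rewrite /= !expr0 mul1r -[(1`!)%:R]/(1 : F) divr1. Qed.

Lemma coef2_pexpM (C : F) (f : pser F) :
  (pexp C * f) 2%N = f 2%N + C * f 1%N + C ^+ 2 / 2%:R * f 0%N.
Proof.
rewrite coef_psM !big_ord_recl big_ord0 !pexpE -[0`!]/1%N -[(bump 0 0)`!]/1%N.
rewrite -[(bump 0 (bump 0 0))`!]/2%N -[(2 - _)%N]/2%N -[(2 - bump 0 0)%N]/1%N.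
by rewrite -[(2 - bump 0 (bump 0 0))%N]/0%N !divr1 expr0 mul1r expr1 addr0 addrA.
Qed.

End Scaling.

Section HookSumEvaluation.
Variables (N a b m : nat).
Local Notation n := m.+1.
Local Notation d := (rk N a b).
Local Notation F := (ratfun d).
Local Notation tofrac := FracField.tofrac.
Local Notation t1 := (t1 N a b).
Hypotheses (N0 : (0 < N)%N) (r : nat) (Dr : a = (b + r)%N).

Local Notation P := (@hook_root N a b m).
Local Notation tn := (chern (t1 *~ n%:Z) : F).

(** The sum over hooks without its pole of order 2 and without its dependence on
    alpha; polynomial in the Chern classes of t1 and the y_k, in each degree. *)
Definition regular_factor : pser F :=
  pexp (content_exponent N a b m r) * hsym (codom P) (r * n)
    * (todd_inv tn * todd_inv (- tn))^-1.

Lemma sum_lval_contribution :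
  \sum_kl lval (contribution a b (@hook_tuple N m kl)) =
  lval (Laurent (- 2%:Z) (pexp (alpha_exponent N a b m) * (psC (- tn ^- 2) * regular_factor))).
Proof.
have char0 := @ratfun_char0 d.
pose p j := tofrac (P j).
have injp : injective p.
  move=> i j /eqP; rewrite tofrac_eq => /eqP/(pexp_inj (F := F)).
  by move/chern_inj/hook_point_inj.
have szp : size (codom p) = (N * n)%N by rewrite size_codom card_prod !card_ord.
under eq_bigr => kl _ do rewrite (lval_contribution Dr kl).
rewrite -mulr_suml -mulr_sumr -(ddiff_codom (fun x => x ^+ (r * n + (N * n).-1)) injp).
rewrite -szp ddiff_expr ?szp; last 2 first.
- by rewrite map_inj_uniq ?enum_uniq.
- by rewrite addn_gt0 muln_gt0 N0.
have -> : codom p = [seq tofrac f | f <- codom P] by rewrite -map_comp.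
rewrite (hsym_map (FracField.tofrac (R := _))).
have tn0 : tn != 0 by rewrite chern_eq0 t1_mulz_eq0.
have -> : chern (t1 *~ - n%:Z) = - tn.
  by rewrite mulrNz raddfN.
have DE (x : F) : 1 - tofrac (pexp (- x)) = tofrac (psX F) * tofrac (psC x * todd_inv x).
  by rewrite -todd_den_scale -tofracM psX_todd_den tofracB tofrac1.
rewrite !DE lval_pser -exprnN.
have Dc : tofrac (psC (- tn ^- 2)) = (tofrac (psC tn) * tofrac (psC (- tn)))^-1.
  have nz0 : tofrac (psC tn) * tofrac (psC (- tn)) != 0.
    rewrite -tofracM psCM tofrac_eq0; apply/eqP => /(congr1 (fun f : pser F => f 0%N)).
    by move/eqP; rewrite /= mulr1 mulrN oppr_eq0 mulf_eq0 orbb (negPf tn0).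
  apply: (mulIf nz0); rewrite mulVf // -!tofracM !psCM -tofrac1 -psC1; congr (tofrac (psC _)).
  exact: neg_square_cancel.
have unitT : todd_inv tn * todd_inv (- tn) \is a GRing.unit.
  by rewrite pser_unitE coef_psM0 !todd_inv0 mulr1 oner_neq0.
rewrite /regular_factor !tofracM Dc rmorphV //= tofracM.
exact: regroup_quotient.
Qed.

Lemma coef_psV0 (f : pser F) : f 0%N = 1 -> f^-1 0%N = 1.
Proof.
move=> f0; have Uf : f \is a GRing.unit by rewrite pser_unitE f0 oner_neq0.
have := congr1 (fun g : pser F => g 0%N) (mulVr Uf).
by rewrite /= -[_ 0%N]/((f^-1 * f) 0%N) coef_psM0 f0 mulr1.
Qed.

(** At b = 0 the exponential and Todd factors and all the points are 1. *)
Lemma regular_factor0 : regular_factor 0%N = 'C(n * (N + r) - 1, n * r)%:R.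
Proof.
have char0 := @ratfun_char0 d.
rewrite coef_psM0 coef_psM0 pexp_coef0 mul1r coef_psV0 ?coef_psM0 ?todd_inv0 ?mulr1 //.
rewrite hsym_coef0; set s := map _ _.
have -> : s = nseq (N * n).-1.+1 1.
  rewrite prednK ?muln_gt0 ?N0 //; transitivity (nseq (size s) (1 : F)).
    by apply/all_pred1P; rewrite /s -map_comp all_map; apply/allP => j _; apply/eqP/pexp_coef0.
  by rewrite size_map size_codom card_prod !card_ord.
rewrite hsym_ones; congr ('C(_, _)%:R); nia.
Qed.

Lemma Vred0E : Vred0 N a b n =
  - (regular_factor 2%N + alpha_exponent N a b m * regular_factor 1%N
     + alpha_exponent N a b m ^+ 2 / 2%:R * regular_factor 0%N) / tn ^+ 2.
Proof.
rewrite Vred0_hooks (lcoef0_sum sum_lval_contribution).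
rewrite -[lcoef0 _]/((pexp (alpha_exponent N a b m) * (psC (- tn ^- 2) * regular_factor)) 2%N).
rewrite coef2_pexpM !coef_psCM.
exact: regroup_quadratic.
Qed.
End HookSumEvaluation.

(** * Specialization of the weights *)

Section Specialization.
Variables (N a b : nat).
Local Notation d := (rk N a b).
Local Notation F := (ratfun d).
Local Notation tofrac := FracField.tofrac.
Implicit Types (c : 'I_(a + b) -> rat) (f g : {mpoly rat[d]}).

HB.instance Definition _ c := GRing.RMorphism.copy (@spec N a b c)
  (mmap polyC (@spec_var N a b c)).

(** Polynomials whose specialization is the same for all weights of alpha, for
    instance those in the Chern classes of t1 and the y_k alone. *)
Definition spec_indep : {pred F} := fun x =>
  `[< exists2 f, x = tofrac f & forall c c', spec c f = spec c' f >].

Lemma spec_indepP x : reflect (exists2 f, x = tofrac f & forall c c', spec c f = spec c' f)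
  (x \in spec_indep).
Proof. exact: asboolP. Qed.

Lemma spec_indep_subring : subring_closed spec_indep.
Proof.
split.
- by apply/spec_indepP; exists 1; rewrite ?tofrac1 // => c c'; rewrite !rmorph1.
- move=> x y /spec_indepP[f -> Ef] /spec_indepP[g -> Eg]; apply/spec_indepP; exists (f - g).
    by rewrite tofracB.
  by move=> c c'; rewrite !rmorphB /= (Ef c c') (Eg c c').
move=> x y /spec_indepP[f -> Ef] /spec_indepP[g -> Eg]; apply/spec_indepP; exists (f * g).
  by rewrite tofracM.
by move=> c c'; rewrite !rmorphM /= (Ef c c') (Eg c c').
Qed.
HB.instance Definition _ := GRing.isSubringClosed.Build F spec_indep spec_indep_subring.

Lemma specX c i : spec c 'X_i = @spec_var N a b c i.
Proof. by rewrite /spec mmapX mmap1U. Qed.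

Lemma spec_var_lam c : @spec_var N a b c (ilam N a b) = 'X.
Proof. by rewrite /spec_var /ilam (unsplitK (inl _)) (unsplitK (inl _)). Qed.
Lemma spec_var_m c k : @spec_var N a b c (im a b k) = 0.
Proof. by rewrite /spec_var /im (unsplitK (inl _)) (unsplitK (inr _)). Qed.
Lemma spec_var_w c i : @spec_var N a b c (iw N i) = c i *: 'X.
Proof. by rewrite /spec_var /iw (unsplitK (inr _)). Qed.

Lemma chern_delta i : chern (delta_mx 0 i) = tofrac 'X_i :> F.
Proof.
rewrite /chern (bigD1 i) //= mxE !eqxx scale1r big1 ?addr0 // => j neji.
by rewrite mxE eqxx (negPf neji) scale0r.
Qed.

Lemma spec_indep_t1 : chern (t1 N a b) \in spec_indep.
Proof.
rewrite /t1 chern_delta; apply/spec_indepP; exists 'X_(ilam N a b) => // c c'.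
by rewrite !specX !spec_var_lam.
Qed.

Lemma spec_indep_y k : chern (@y N a b k) \in spec_indep.
Proof.
rewrite /y chern_delta; apply/spec_indepP; exists 'X_(im a b k) => // c c'.
by rewrite !specX !spec_var_m.
Qed.

Lemma spec_indep_invn k : (k%:R)^-1 \in spec_indep.
Proof.
apply/spec_indepP; exists (@mpolyC d rat (k%:R)^-1).
  case: k => [|k]; first by rewrite !mulr0n !invr0 mpolyC0 tofrac0.
  apply: (mulIf (ratfun_char0 d k)); rewrite mulVf ?ratfun_char0 //.
  rewrite -(rmorph_nat (FracField.tofrac (R := _))) -(rmorph_nat (@mpolyC d rat)).
  by rewrite -tofracM -mpolyCM mulVf ?pnatr_eq0 // tofrac1.
by move=> c c'; rewrite /spec !mmapC.
Qed.

Lemma spec_indep_pexp x : x \in spec_indep -> ps_over spec_indep (pexp x).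
Proof. by move=> wx n; rewrite pexpE rpredM ?rpredX ?spec_indep_invn. Qed.

Lemma spec_indep_todd x : x \in spec_indep -> ps_over spec_indep (todd_inv x).
Proof. by move=> wx n; rewrite /= !rpredM ?rpredX ?spec_indep_invn ?rpredN ?rpred1. Qed.

Variables (m r : nat).

Lemma spec_indep_regular_factor : ps_over spec_indep (regular_factor N a b m r).
Proof.
have wtn : chern (t1 N a b *~ m.+1%:Z) \in spec_indep.
  by rewrite -[_ *~ _]/(_ *+ _) chernMn rpredMn ?spec_indep_t1.
apply: ps_overM; first apply: ps_overM.
- by apply: spec_indep_pexp; rewrite !rpredMn ?rpredN ?spec_indep_t1.
- apply: hsym_over => f /codomP[j ->]; apply: spec_indep_pexp.
  rewrite chernD rpredD ?spec_indep_y // -[_ *~ _]/(_ *+ _) chernMn.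
  by rewrite rpredMn ?spec_indep_t1.
apply: ps_overV; first by rewrite coef_psM0 !todd_inv0 mulr1.
by apply: ps_overM; apply: spec_indep_todd; rewrite ?rpredN.
Qed.

Definition alpha_form : {mpoly rat[d]} :=
  \sum_(i < a) 'X_(iw N (lshift b i)) - \sum_(j < b) 'X_(iw N (rshift a j)).

Lemma chern_vdet_alpha : chern (vdet (alpha N a b)) = tofrac alpha_form.
Proof.
have E (I : finType) (f : I -> 'I_d) :
    chern (vdet (\sum_i vwt (delta_mx 0 (f i)))) = tofrac (\sum_i 'X_(f i)) :> F.
  rewrite (raddf_sum (@vdet d)) !raddf_sum; apply: eq_bigr => i _.
  by rewrite /= vdetU chern_delta.
by rewrite (raddfB (@vdet d)) chernB tofracB -!E.
Qed.

Lemma spec_alpha_form c : spec c alpha_form = c1 c *: 'X.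
Proof.
rewrite rmorphB !rmorph_sum /c1 scalerBl !scaler_suml /=.
by congr (_ - _); apply: eq_bigr => i _; rewrite specX spec_var_w.
Qed.
End Specialization.

Lemma double_quotient (K : fieldType) (w0 w1 w2 c t : K) : 2%:R != 0 :> K ->
  - (w2 + c * w1 + c ^+ 2 / 2%:R * w0) / t ^+ 2 =
  - (w2 *+ 2 + c *+ 2 * w1 + c ^+ 2 * w0) / (t ^+ 2 *+ 2).
Proof.
move=> nz2; have [->|nzt] := eqVneq t 0; first by rewrite expr0n mul0rn !invr0 !mulr0.
by field; rewrite nzt nz2.
Qed.

(** A quadratic function of s is determined by its values at 1, 0 and -1, and its
    second difference sees only the coefficient of s^2. *)
Lemma second_difference (x y u v w k : rat) : k != 0 ->
  (forall s, (x * s ^+ 2 + y) * (k ^+ 2 * 2%:R) =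
     - (v * 2%:R + s * k * 2%:R * u + (s * k) ^+ 2 * w)) ->
  x = - (1 / 2%:R) * w.
Proof.
move=> k0 E; have k2 : k ^+ 2 * 4%:R != 0 by rewrite mulf_neq0 ?expf_neq0.
apply: (mulIf k2); (* Opaque before rewriting, since (-1) ^+ 2 and 1 ^+ 2 are convertible. *)
pose f s := (x * s ^+ 2 + y) * (k ^+ 2 * 2%:R).
have -> : x * (k ^+ 2 * 4%:R) = f 1 + f (-1) - 2%:R * f 0 by rewrite /f; ring.
have Ef s : f s = _ := E s.
by clearbody f; rewrite !Ef; field.
Qed.

Theorem corollary1p16 (N n r : nat) (hN : (0 < N)%N) (hn : (0 < n)%N)
  (hr : (0 < r)%N) (B1 : nat -> rat) (hB1 : is_B1 N r B1) :
  B1 n = - (1 / 2%:R) * ('C(n * (N + r) - 1, n * r))%:R.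
Proof.
case: n hn => // m _; case: hB1 => B0 decomp.
pose d := rk N (0 + r) 0.
pose F := ratfun d; pose W := regular_factor N (0 + r) 0 m r.
have wW i : exists2 f, W i = FracField.tofrac f &
    forall c c' : 'I_(0 + r + 0) -> rat, spec c f = spec c' f.
  exact/spec_indepP/spec_indep_regular_factor.
have [w1 Dw1 Ew1] := wW 1%N; have [w2 Dw2 Ew2] := wW 2%N.
pose w0 := 'C(m.+1 * (N + r) - 1, m.+1 * r).
pose L := alpha_form N (0 + r) 0; pose X : {mpoly rat[d]} := 'X_(ilam N (0 + r) 0).
(* Twice the numerator of the degree 0 part, over (n lambda)^2. *)
pose num := w2 *+ 2 + L *+ m.+1 *+ 2 * w1 + (L *+ m.+1) ^+ 2 * w0%:R.
have DV : Vred0 N (0 + r) 0 m.+1 =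
    - FracField.tofrac num / FracField.tofrac ((X *+ m.+1) ^+ 2 *+ 2).
  rewrite (Vred0E m hN (erefl (0 + r)%N)) /alpha_exponent chern_vdet_alpha.
  rewrite -[_ *~ _]/(_ *+ _) chernMn /t1 chern_delta -/L -/X -/W Dw1 Dw2 regular_factor0 //.
  rewrite /num !(tofracD, tofracM, tofracMn, tofracXn).
  apply: double_quotient; first exact: ratfun_char0 1%N.
(* Uniqueness of the restriction: cross-multiply in the polynomial ring, then
   specialize. *)
have key (c : 'I_(0 + r + 0) -> rat) :
    (B1 m.+1 * c1 c ^+ 2 + B0 m.+1) *: (('X *+ m.+1) ^+ 2 *+ 2) = - spec c num.
  have [f1 [f2 [nz2 DV' Ex]]] := decomp _ _ c erefl m.+1.
  have nzf2 : f2 != 0 by apply: contraNneq nz2 => ->; rewrite rmorph0.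
  have nzX : X *+ m.+1 != 0.
    rewrite -tofrac_eq0 tofracMn -chern_delta -chernMn chern_eq0.
    by rewrite -[_ *+ _]/(_ *~ m.+1%:Z) t1_mulz_eq0.
  have nzD : (X *+ m.+1) ^+ 2 *+ 2 != 0.
    rewrite -mulr_natr mulf_neq0 ?expf_neq0 //.
    by rewrite -(rmorph_nat (@mpolyC d rat)) mpolyC_eq0 pnatr_eq0.
  have /eqP : f1 * ((X *+ m.+1) ^+ 2 *+ 2) = - num * f2.
    move: DV'; rewrite DV => /eqP.
    rewrite -tofracN eqr_div ?tofrac_eq0 // -!tofracM tofrac_eq eq_sym.
    by move/eqP.
  move/eqP/(congr1 (spec c)); rewrite !rmorphM rmorphN /= Ex -scalerAl [spec c f2 * _]mulrC.
  rewrite scalerAl => /(mulIf nz2) <-.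
  by rewrite rmorphMn rmorphXn rmorphMn /= specX spec_var_lam.
(* Equal weights s / r for the r summands of alpha make c_1(alpha) = s lambda. *)
pose cs (s : rat) : 'I_(0 + r + 0) -> rat := fun=> s / r%:R.
have c1s s : c1 (cs s) = s.
  rewrite /c1 /cs big_ord0 subr0 sumr_const card_ord add0n -[LHS]mulr_natr divfK //.
  by rewrite pnatr_eq0 -lt0n.
pose v1 := (spec (cs 0) w1).[1]; pose v2 := (spec (cs 0) w2).[1].
have eval s : (B1 m.+1 * s ^+ 2 + B0 m.+1) * (m.+1%:R ^+ 2 * 2%:R) =
    - (v2 * 2%:R + s * m.+1%:R * 2%:R * v1 + (s * m.+1%:R) ^+ 2 * w0%:R).
  have := congr1 (horner^~ 1) (key (cs s)).
  rewrite /num 2!rmorphD 2!rmorphM rmorphXn !rmorphMn rmorph1 /=.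
  rewrite spec_alpha_form c1s (Ew1 _ (cs 0)) (Ew2 _ (cs 0)).
  rewrite !(hornerD, hornerM, hornerMn, hornerZ, hornerX, hornerN, horner_exp, hornerC) -/v1 -/v2.
  by rewrite mulr1 [m.+1%:R ^+ 2]expr2 !mulr_natr -!mulr2n.
by apply: (second_difference _ eval); rewrite pnatr_eq0.
Qed.
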